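(* Let $\mathbb{L}^2$ be the two-dimensional lattice with vertex set $\mathbb{Z}^2$ and edges between nearest neighbours (points at $\ell^1$-distance $1$). Let $v_1,v_2,\dots$ be a sequence of vertices such that $v_k$ is at distance $k$ from $0$ in $\mathbb{L}^2$. Let $\varepsilon\in[0,1]$ and let $(X,Y)$ be a binary synchronization instance drawn from $P_{\mathbb{L}^2,Q}$, where all the edge channels are binary symmetric channels with flip probability $\varepsilon$. If $(1-2\varepsilon)^2\le\frac12$, then $$I_2(X_0;X_{v_k}\mid Y)\to0\quad\text{as }k\to\infty.$$
   Context: The binary synchronization instance is: $X=(X_v)_{v\in\mathbb{Z}^2}$ are i.i.d. uniform on $\{-1,+1\}$, and for each edge $e=(i,j)$ of $\mathbb{L}^2$ one observes $Y_e$, the output of a binary symmetric channel with flip probability $\varepsilon$ on input $X_iX_j$: conditionally on $X$ the $Y_e$ are independent with $Y_e=X_iX_j$ with probability $1-\varepsilon$ and $Y_e=-X_iX_j$ with probability $\varepsilon$. $Y=(Y_e)_{e\in E(\mathbb{L}^2)}$. $\chi^2$-mutual information. For random variables $A,B$ with joint law $\nu_{A,B}\ll\nu_A\times\nu_B$, $I_2(A;B)=\int\left(\frac{d\nu_{A,B}}{d(\nu_A\times\nu_B)}-1\right)^2 d(\nu_A\times\nu_B)$. The conditional version $I_2(A;B\mid C)$ is the expectation over $C$ of the $\chi^2$-mutual information of the conditional joint law of $(A,B)$ given $C$. *)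

(* Defs.v *)
From HB Require Import structures.
From mathcomp Require Import all_boot all_order all_algebra finmap.
From mathcomp Require Import all_classical all_reals all_analysis.
From mathcomp Require Import measurable_realfun.

Set Implicit Arguments.
Unset Strict Implicit.
Unset Printing Implicit Defensive.

Import Order.TTheory GRing.Theory Num.Theory.
Import numFieldNormedType.Exports.

Local Open Scope classical_set_scope.
Local Open Scope ring_scope.
Local Open Scope charge_scope.

Definition vertex : Type := (int * int)%type.

Definition origin : vertex := (0, 0).

Definition l1dist (u v : vertex) : nat := (`|u.1 - v.1| + `|u.2 - v.2|)%N.

Definition adj : rel vertex := fun u v => l1dist u v == 1%N.

Definition graph_dist (V : eqType) (e : rel V) (u v : V) (k : nat) : Prop :=
  (exists p, [/\ path e u p, last u p = v & size p = k]) /\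
  (forall p, path e u p -> last u p = v -> (k <= size p)%N).

(* Each undirected edge is listed once, by its endpoints in increasing
   coordinatewise order: neighbours differ in exactly one coordinate, so
   exactly one of the two orientations of an edge satisfies this. *)
Definition is_edge (e : vertex * vertex) : bool :=
  [&& adj e.1 e.2, e.1.1 <= e.2.1 & e.1.2 <= e.2.2].

Definition edge : Type := {e : vertex * vertex | is_edge e}.

Definition src (e : edge) : vertex := (val e).1.
Definition tgt (e : edge) : vertex := (val e).2.

HB.instance Definition _ d1 d2 (T1 : measurableType d1)
  (T2 : measurableType d2) :=
  isMeasurableFun.Build _ _ (T1 * T2)%type T1 (@fst T1 T2) measurable_fst.
HB.instance Definition _ d1 d2 (T1 : measurableType d1)
  (T2 : measurableType d2) :=
  isMeasurableFun.Build _ _ (T1 * T2)%type T2 (@snd T1 T2) measurable_snd.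

Section chi2_information.
Context d1 d2 (T1 : measurableType d1) (T2 : measurableType d2) (R : realType).
Variable nu : probability (T1 * T2)%type R.

Definition marginal_product : probability (T1 * T2)%type R :=
  (distribution nu (@fst T1 T2) \x distribution nu (@snd T1 T2))%E.

(* I_2(A; B) as a function of the joint law nu of (A, B); the value +oo
   without absolute continuity is the usual convention, and such laws do not
   exist on finite alphabets. *)
Definition chi2_mi : \bar R :=
  if `[< nu `<< marginal_product >] then
    (\int[marginal_product]_z
      ((fine ('d (charge_of_finite_measure nu) '/d marginal_product z) - 1)
         ^+ 2)%:E)%E
  else +oo%E.

End chi2_information.

Section conditioning.
Context d (Omega : measurableType d) (R : realType) (P : probability Omega R).

Definition sigma_gen (I : Type) d' (T : measurableType d')
    (W : I -> Omega -> T) : set (set Omega) :=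
  <<s \bigcup_(i in [set: I]) preimage_set_system [set: Omega] (W i) measurable >>.

(* f is a version of the conditional probability of A given G. *)
Definition is_cond_prob (G : set (set Omega)) (A : set Omega)
    (f : Omega -> \bar R) : Prop :=
  [/\ forall B : set (\bar R), measurable B -> G (f @^-1` B),
      P.-integrable [set: Omega] f &
      forall B, G B -> (\int[P]_(w in B) f w = P (A `&` B))%E].

(* kappa is a regular version of the conditional law of Z given G. *)
Definition is_cond_law d' (T : measurableType d') (G : set (set Omega))
    (Z : Omega -> T) (kappa : Omega -> probability T R) : Prop :=
  forall A : set T, measurable A ->
    is_cond_prob G (Z @^-1` A) (fun w => kappa w A).

Definition cond_chi2_mi d1 d2 (T1 : measurableType d1) (T2 : measurableType d2)
    (kappa : Omega -> probability (T1 * T2)%type R) : \bar R :=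
  (\int[P]_w chi2_mi (kappa w))%E.

Definition mutually_independent (I : choiceType) d' (T : measurableType d')
    (W : I -> {RV P >-> T}) : Prop :=
  forall (F : {fset I}) (A : I -> set T), (forall i, measurable (A i)) ->
    (P (\bigcap_(i in [set` F]) (W i @^-1` A i)) =
     \prod_(i <- F) P (W i @^-1` A i))%E.

End conditioning.

(* The alphabet {-1, +1} is encoded by bool through b |-> (-1) ^+ b, so that
   the product of signs is addb. *)
Definition bsc (R : realType) (eps : R) (x y : bool) : R :=
  if y == x then 1 - eps else eps.

Section instance.
Context d (Omega : measurableType d) (R : realType) (P : probability Omega R).

Record sync_instance (eps : R) (X : vertex -> {RV P >-> bool})
    (Y : edge -> {RV P >-> bool}) : Prop := SyncInstance {
  spin_uniform : forall v b, P (X v @^-1` [set b]) = (2^-1)%:E ;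
  spin_indep : mutually_independent X ;
  obs_cond_law : forall (F : {fset edge}) (y : edge -> bool),
    is_cond_prob P (sigma_gen (fun v => X v : Omega -> bool))
      (\bigcap_(e in [set` F]) (Y e @^-1` [set y e]))
      (fun w => (\prod_(e <- F)
         bsc eps (X (src e) w (+) X (tgt e) w) (y e))%:E)
}.

End instance.

(* Main.v *)
Require Import Defs.
From HB Require Import structures.
From mathcomp Require Import all_boot all_order all_algebra finmap.
From mathcomp Require Import all_classical all_reals all_analysis.
From mathcomp Require Import measurable_realfun.
From mathcomp Require Import zify ring lra.

Set Implicit Arguments.
Unset Strict Implicit.
Unset Printing Implicit Defensive.

Import Order.TTheory GRing.Theory Num.Theory.
Import numFieldNormedType.Exports.

Local Open Scope classical_set_scope.
Local Open Scope ring_scope.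

(* Given Y, the two spins are uniform and I_2 is the square of the conditional
   mean rho of the product of their signs. Since rho^2 <= |rho|, it suffices to
   bound E[(-1)^(X_0 + X_v); B] for B in sigma(Y), and by approximation for B
   depending on finitely many observations.

   For finitely many edges, replacing one symmetric channel by an erasure
   channel which reveals X_i X_j with probability 1/2 >= (1 - 2 eps)^2 increases
   the expected squared correlation. When all edges are replaced it is at most
   the probability that 0 and v are connected in bond percolation at 1/2, which
   is small by Harris' theorem.

   Harris' theorem is obtained without Russo-Seymour-Welsh estimates. If some
   box were connected to arbitrarily large distances with probability close to
   1, then, by the square-root trick and self-duality, every translate of it
   inside a wide strip would have two open and two dual closed arms, in
   alternating order, to prescribed parts of the boundary of the strip. It
   would be pivotal with probability at least 1/2 for one and the same crossing
   event. Bessel's inequality bounds the number of disjoint blocks that can have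
   this property. *)

(** * Averages over fair coins *)

Section Average.
Variables (R : realType) (U : eqType).
Implicit Types (w : U -> bool) (L : seq U) (f g : (U -> bool) -> R).

(** The hypothesis allows [(1 - 2 * eps) ^+ 2 = 2^-1], so the comparison lands exactly on the
    critical density 1/2, where counting paths fails and self-duality has to do the work. That is
    why the percolation estimate carries the bulk of the proof. In the pivotality argument the order
    of choices is the obstacle: the size of the box fixes the number K of disjoint blocks that
    contradicts Bessel's bound, K fixes a width J holding all of them, and only afterwards is the
    rectangle chosen. The arms must therefore end farther than J from the axis, so that the arms of
    every translated block hit the same halves of the two sides. An arm probability of 7/8 is what
    is wanted: two arms together then have probability at least 3/4 without any independence, and
    3/4 - 1/4 = 1/2. Passing to |rho| makes the infinite set of observations harmless. E|rho| is
    read off from the two events rho >= 0 and rho < 0, and E[(-1)^(X_0 + X_v); B] is continuous in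
    B, so conditional laws given growing finite sets of edges never have to converge. The finite
    comparison controls squared correlations; a weighted AM-GM inequality leads back to |rho|, at
    the price of a square root. *)

Definition upd w e b : U -> bool := fun x => if x == e then b else w x.

(** Expectation over independent fair coins at the entries of [L], with [w] supplying all other
    coordinates. Every percolation probability below is such a finite average. *)
Fixpoint avg L f w : R :=
  if L is e :: L' then (avg L' f (upd w e true) + avg L' f (upd w e false)) / 2
  else f w.

Lemma avg_cat L1 L2 f : avg (L1 ++ L2) f = avg L1 (avg L2 f).
Proof. by apply/funext => w; elim: L1 w => //= e L1 IH w; rewrite !IH. Qed.

Lemma eq_avg L f g : f =1 g -> avg L f =1 avg L g.
Proof. by move=> fg; elim: L => //= e L IH w; rewrite !IH. Qed.

Lemma avgD L f g w : avg L (fun w => f w + g w) w = avg L f w + avg L g w.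
Proof. by elim: L w => //= e L IH w; rewrite !IH; field. Qed.

Lemma avgZ L c f w : avg L (fun w => c * f w) w = c * avg L f w.
Proof. by elim: L w => //= e L IH w; rewrite !IH; field. Qed.

Lemma le_avg L f g w : (forall w, f w <= g w) -> avg L f w <= avg L g w.
Proof.
by move=> fg; elim: L w => //= e L IH w; rewrite ler_pM2r ?invr_gt0 // lerD.
Qed.

Lemma updC w e e' b b' : e != e' ->
  upd (upd w e b) e' b' = upd (upd w e' b') e b.
Proof.
move=> ne; apply/funext => x; rewrite /upd; case: (eqVneq x e') => // ->.
by rewrite eq_sym (negPf ne).
Qed.

Lemma upd_upd w e b b' : upd (upd w e b) e b' = upd w e b'.
Proof. by apply/funext => x; rewrite /upd; case: eqP. Qed.

Lemma avgC L1 L2 f w : avg L1 (avg L2 f) w = avg L2 (avg L1 f) w.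
Proof.
have swap1 e : forall L f w, avg [:: e] (avg L f) w = avg L (avg [:: e] f) w.
  elim=> //= e' L IH g w'.
  have := IH g (upd w' e' true); have := IH g (upd w' e' false) => /= <- <-.
  have [->|ne] := eqVneq e e'; first by rewrite !upd_upd.
  by rewrite !(updC w' _ _ ne); field.
elim: L1 f w => // e L1 IH f w.
rewrite -[e :: L1]cat1s avg_cat (eq_avg [:: e] (IH f)) swap1.
by rewrite avg_cat.
Qed.

Lemma perm_avg L1 L2 f w : perm_eq L1 L2 -> avg L1 f w = avg L2 f w.
Proof.
move=> p12; pose P s := avg L1 f w = avg s f w.
have PC s1 s2 s3 : P (s1 ++ s2 ++ s3) -> P (s2 ++ s1 ++ s3).
  by rewrite /P => ->; rewrite !avg_cat avgC.
exact: (catCA_perm_ind PC p12).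
Qed.

Definition depends T (f : (U -> bool) -> T) (S : U -> Prop) :=
  forall w w', (forall e, S e -> w e = w' e) -> f w = f w'.

Lemma depends_sub T (f : (U -> bool) -> T) (S S' : U -> Prop) :
  (forall e, S e -> S' e) -> depends f S -> depends f S'.
Proof. by move=> ss fS w w' ww'; apply: fS => e /ss /ww'. Qed.

Lemma avg_out L f (S : U -> Prop) w : depends f S ->
  (forall e, e \in L -> ~ S e) -> avg L f w = f w.
Proof.
move=> fS; elim: L w => //= e L IH w nS.
have nS' e' : e' \in L -> ~ S e' by move=> h; apply: nS; rewrite inE h orbT.
rewrite !IH //.
have fu b : f (upd w e b) = f w.
  apply: fS => x Sx; rewrite /upd; case: eqP => // xe.
  by case: (nS e); rewrite ?mem_head // -xe.
by rewrite !fu; field.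
Qed.

Lemma depends_avg L f S : depends f S ->
  depends (avg L f) (fun e => S e /\ e \notin L).
Proof.
move=> fS; elim: L => [|e L IH] w w' ww' /=; first by apply: fS => e; auto.
by congr ((_ + _) / 2); apply: IH => x [Sx xL]; rewrite /upd; case: eqP => // xe;
  apply: ww'; rewrite inE (negPf xL) orbF; split => //; apply/eqP.
Qed.

Lemma avgM_out L f g S w : depends f S -> (forall e, e \in L -> ~ S e) ->
  avg L (fun w => f w * g w) w = f w * avg L g w.
Proof.
move=> fS; elim: L w => //= e L IH w nS.
have nS' e' : e' \in L -> ~ S e' by move=> h; apply: nS; rewrite inE h orbT.
rewrite !IH //.
have fu b : f (upd w e b) = f w.
  apply: fS => x Sx; rewrite /upd; case: eqP => // xe.
  by case: (nS e); rewrite ?mem_head // -xe.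
by rewrite !fu; field.
Qed.

Lemma avg_indep L f g (S : pred U) w : depends f S -> depends g (fun e => ~~ S e) ->
  avg L (fun w => f w * g w) w = avg L f w * avg L g w.
Proof.
move=> fS gS.
have pL : perm_eq L ([seq e <- L | S e] ++ [seq e <- L | ~~ S e]).
  by rewrite perm_sym; apply/permPl/perm_filterC.
rewrite !(perm_avg _ _ pL) !avg_cat.
have oS e : e \in [seq e <- L | ~~ S e] -> ~ S e.
  by rewrite mem_filter => /andP[/negP].
have oN e : e \in [seq e <- L | S e] -> ~ ~~ S e.
  by rewrite mem_filter => /andP[->].
rewrite (eq_avg _ (fun w => avgM_out _ w fS oS)).
rewrite [in RHS](eq_avg _ (fun w => avg_out w fS oS)).
have gS' : depends (avg [seq e <- L | ~~ S e] g) (fun e => ~~ S e).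
  by apply: depends_sub (depends_avg gS) => e [].
rewrite (avg_out _ gS' oN).
rewrite (eq_avg _ (g := fun w => avg [seq e <- L | ~~ S e] g w * f w)); last first.
  by move=> v; rewrite mulrC.
by rewrite (avgM_out f w gS' oN) mulrC.
Qed.

(* Both sides equal the mean over the coins in the support of f. *)
Lemma avg_supp L1 L2 f (S : U -> Prop) w1 w2 : uniq L1 -> uniq L2 -> depends f S ->
  (forall e, S e -> e \in L1) -> (forall e, S e -> e \in L2) ->
  avg L1 f w1 = avg L2 f w2.
Proof.
move=> u1 u2 fS S1 S2; pose s := fun e => `[< S e >].
have red L w : uniq L -> (forall e, S e -> e \in L) ->
    avg L f w = avg [seq e <- L | s e] f w.
  move=> uL SL.
  have pL : perm_eq L ([seq e <- L | s e] ++ [seq e <- L | ~~ s e]).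
    by rewrite perm_sym; apply/permPl/perm_filterC.
  rewrite (perm_avg _ _ pL) avg_cat; apply: eq_avg => v; apply: (avg_out v fS) => e.
  by rewrite mem_filter => /andP[/asboolPn].
rewrite (red _ w1 u1 S1) (red _ w2 u2 S2).
have /perm_avg -> : perm_eq [seq e <- L1 | s e] [seq e <- L2 | s e].
  apply: uniq_perm; rewrite ?filter_uniq // => e; rewrite !mem_filter.
  by rewrite /s; case: asboolP => //= Se; rewrite S1 ?S2.
apply: (depends_avg fS) => e [Se]; rewrite mem_filter S2 // andbT => /negP.
by case; apply/asboolP.
Qed.

Definition le_cfg w w' := forall e, w e -> w' e.

Definition increasing (f : (U -> bool) -> R) :=
  forall w w', le_cfg w w' -> f w <= f w'.

Lemma le_upd w w' e b : le_cfg w w' -> le_cfg (upd w e b) (upd w' e b).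
Proof. by move=> ww' x; rewrite /upd; case: eqP => // _ /ww'. Qed.

Lemma avg_increasing L f : increasing f -> increasing (avg L f).
Proof.
move=> fi; elim: L => //= e L IH w w' ww'.
by rewrite ler_pM2r ?invr_gt0 //; apply: lerD; apply/IH/le_upd.
Qed.

(** Induction on the coins. A single coin is Chebyshev's inequality on two points,
    [(f1 - f0) * (g1 - g0) >= 0]. *)
Lemma avg_FKG L f g w : increasing f -> increasing g ->
  avg L f w * avg L g w <= avg L (fun w => f w * g w) w.
Proof.
move=> fi gi; elim: L w => //= e L IH w.
have tf : le_cfg (upd w e false) (upd w e true).
  by move=> x; rewrite /upd; case: eqP.
have := avg_increasing L fi tf; have := avg_increasing L gi tf.
have := IH (upd w e true); have := IH (upd w e false).
set f1 := avg L f _; set f0 := avg L f _; set g1 := avg L g _; set g0 := avg L g _.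
by move=> *; nra.
Qed.

Definition setcfg (B : seq U) b w : U -> bool := fun e => if e \in B then b else w e.

(** Restricting to the event that the whole block [B] has the value [b] amounts to evaluating [f] at
    the modified configuration, at the cost [2 ^+ size B]. This is the finite-energy property used
    for closing rows and for opening or closing pads. *)
Lemma avg_setcfg B b f w : uniq B ->
  avg B (fun w => (all (fun e => w e == b) B)%:R * f w) w =
  f (setcfg B b w) / 2 ^+ size B.
Proof.
move=> uB.
suff gen (B1 : seq U) (w' : U -> bool) : uniq B1 ->
    avg B1 (fun w => (all (fun e => w e == b) B1)%:R * f w) w' =
    f (setcfg B1 b w') / 2 ^+ size B1 by exact: gen.
elim: B1 f w' {B uB w} => [|e B IH] f w /= => [_|/andP[eB uB]].
  by rewrite mul1r divr1; congr f.
have step c : avg B (fun w0 => ((w0 e == b) && all (fun e0 => w0 e0 == b) B)%:R * f w0)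
    (upd w e c) = (c == b)%:R * (f (setcfg B b (upd w e c)) / 2 ^+ size B).
  rewrite -IH //.
  rewrite (eq_avg B (g := fun w0 => (w0 e == b)%:R *
     ((all (fun e0 => w0 e0 == b) B)%:R * f w0))); last first.
    by move=> v; rewrite mulrA -natrM mulnb.
  rewrite (@avgM_out B (fun w0 => (w0 e == b)%:R) _ (eq e)).
  - by rewrite /upd eqxx.
  - by move=> v v' vv'; rewrite vv'.
  - by move=> x xB ex; move: eB; rewrite ex xB.
have cE : setcfg B b (upd w e b) = setcfg (e :: B) b w.
  by apply/funext => x; rewrite /setcfg /upd inE; case: eqP => //= _; case: (_ \in _).
rewrite !step exprS -cE; case: b {IH step cE} => /=; rewrite ?(mul0r, mul1r, add0r, addr0) ?eqxx;
 by rewrite invfM; lra.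
Qed.

End Average.

(** * Means and probabilities of functions of finitely many coins *)

Section Mean.
Variables (R : realType) (U : eqType).
Implicit Types (w : U -> bool) (L : seq U) (f g : (U -> bool) -> R)
  (A B : (U -> bool) -> Prop).

Definition cyl T (f : (U -> bool) -> T) := exists L, depends f (fun e => e \in L).

Lemma cyl_comp2 T1 T2 T (h : T1 -> T2 -> T) (f : (U -> bool) -> T1)
    (g : (U -> bool) -> T2) :
  cyl f -> cyl g -> cyl (fun w => h (f w) (g w)).
Proof.
move=> [L fL] [L' gL]; exists (L ++ L') => w w' ww'.
by rewrite (fL w w') ?(gL w w') // => e eL; apply: ww'; rewrite mem_cat eL ?orbT.
Qed.

Lemma cyl_comp T1 T (h : T1 -> T) (f : (U -> bool) -> T1) :
  cyl f -> cyl (fun w => h (f w)).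
Proof. by move=> [L fL]; exists L => w w' ww'; rewrite (fL w w'). Qed.

Lemma cyl_cst T (c : T) : cyl (fun _ : U -> bool => c).
Proof. by exists [::]. Qed.

(** The support is picked by choice, with 0 as default when there is none; [meanE] shows that any
    duplicate-free support and any background configuration give the same value. *)
Definition mean f : R :=
  if pselect (cyl f) is left h then avg (undup (projT1 (cid h))) f (fun=> false) else 0.

Lemma meanE f L w : uniq L -> depends f (fun e => e \in L) -> mean f = avg L f w.
Proof.
move=> uL fL; rewrite /mean; case: pselect => [h|[]]; last by exists L.
have fL' := projT2 (cid h).
pose S e := e \in L /\ e \in projT1 (cid h).
have fS : depends f S.
  (* Two supports intersect in a support: the hybrid [w3] agrees with [w1] on the first and with
     [w2] on the second. *)
  move=> w1 w2 w12; pose w3 e := if e \in L then w1 e else w2 e.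
  rewrite (fL w1 w3); last by move=> e eL; rewrite /w3 eL.
  by apply: fL' => e eL'; rewrite /w3; case: ifP => // eL; apply: w12.
by apply: (avg_supp _ _ _ _ fS) => //; rewrite ?undup_uniq // => e []; rewrite // mem_undup.
Qed.

Lemma cyl_list f : cyl f -> exists2 L, uniq L & depends f (fun e => e \in L).
Proof.
move=> [L fL]; exists (undup L); rewrite ?undup_uniq //.
by apply: depends_sub fL => e; rewrite mem_undup.
Qed.

Lemma cyl_list2 f g : cyl f -> cyl g ->
  exists L, [/\ uniq L, depends f (fun e => e \in L) & depends g (fun e => e \in L)].
Proof.
move=> [L fL] [L' gL]; exists (undup (L ++ L')); split; rewrite ?undup_uniq //.
  by apply: depends_sub fL => e eL; rewrite mem_undup mem_cat eL.
by apply: depends_sub gL => e eL; rewrite mem_undup mem_cat eL orbT.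
Qed.

Lemma depends_comp2 T1 T2 T (h : T1 -> T2 -> T) (f : (U -> bool) -> T1)
    (g : (U -> bool) -> T2) S :
  depends f S -> depends g S -> depends (fun w => h (f w) (g w)) S.
Proof. by move=> fS gS w w' ww'; rewrite (fS w w') ?(gS w w'). Qed.

Let w0 : U -> bool := fun=> false.

Lemma meanD f g : cyl f -> cyl g -> mean (fun w => f w + g w) = mean f + mean g.
Proof.
move=> cf cg; have [L [uL fL gL]] := cyl_list2 cf cg.
by rewrite (meanE w0 uL (depends_comp2 _ fL gL)) (meanE w0 uL fL) (meanE w0 uL gL) avgD.
Qed.

Lemma meanZ c f : cyl f -> mean (fun w => c * f w) = c * mean f.
Proof.
move=> /cyl_list[L uL fL]; rewrite (meanE w0 uL fL) (meanE w0 uL) ?avgZ //.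
by move=> w w' ww'; rewrite (fL w w').
Qed.

Lemma meanB f g : cyl f -> cyl g -> mean (fun w => f w - g w) = mean f - mean g.
Proof.
move=> cf cg; rewrite -[- mean g]mulN1r -meanZ // -meanD //; last exact: (cyl_comp _ cg).
by congr mean; apply/funext => w; rewrite mulN1r.
Qed.

Lemma mean_cst c : mean (fun=> c) = c.
Proof. by rewrite (@meanE _ [::] w0). Qed.

Lemma le_mean f g : cyl f -> cyl g -> (forall w, f w <= g w) -> mean f <= mean g.
Proof.
move=> cf cg fg; have [L [uL fL gL]] := cyl_list2 cf cg.
by rewrite (meanE w0 uL fL) (meanE w0 uL gL); apply: le_avg.
Qed.

Lemma mean_sum (I : Type) (r : seq I) (F : I -> (U -> bool) -> R) :
  (forall i, cyl (F i)) ->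
  cyl (fun w => \sum_(i <- r) F i w) /\
  mean (fun w => \sum_(i <- r) F i w) = \sum_(i <- r) mean (F i).
Proof.
move=> cF; elim: r => [|i r [IHc IH]].
  rewrite big_nil -[RHS](mean_cst 0); split; last by congr mean; apply/funext => w; rewrite big_nil.
  by exists [::] => w w' _; rewrite !big_nil.
have -> : (fun w => \sum_(j <- i :: r) F j w) = (fun w => F i w + \sum_(j <- r) F j w).
  by apply/funext => w; rewrite big_cons.
by split; [exact: cyl_comp2|rewrite meanD // IH big_cons].
Qed.

Lemma mean_FKG f g : cyl f -> cyl g -> increasing f -> increasing g ->
  mean f * mean g <= mean (fun w => f w * g w).
Proof.
move=> cf cg fi gi; have [L [uL fL gL]] := cyl_list2 cf cg.
rewrite (meanE w0 uL (depends_comp2 _ fL gL)) (meanE w0 uL fL) (meanE w0 uL gL).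
exact: avg_FKG.
Qed.

Lemma mean_indep f g (S : pred U) : cyl f -> cyl g ->
  depends f S -> depends g (fun e => ~~ S e) ->
  mean (fun w => f w * g w) = mean f * mean g.
Proof.
move=> cf cg fS gS; have [L [uL fL gL]] := cyl_list2 cf cg.
rewrite (meanE w0 uL (depends_comp2 _ fL gL)) (meanE w0 uL fL) (meanE w0 uL gL).
exact: avg_indep fS gS.
Qed.

Lemma cyl_setcfg T (f : (U -> bool) -> T) (B : seq U) b :
  cyl f -> cyl (fun w => f (setcfg B b w)).
Proof.
move=> [L fL]; exists L => w w' ww'; apply: fL => e eL; rewrite /setcfg.
by case: ifP => // _; apply: ww'.
Qed.

Definition allis (B : seq U) b w := all (fun e => w e == b) B.

Lemma cyl_allis (B : seq U) b : cyl (fun w => (allis B b w)%:R : R).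
Proof.
exists B => w w' ww'; congr (nat_of_bool _)%:R.
by apply: eq_in_all => e eB; rewrite ww'.
Qed.

Lemma mean_allis f (B : seq U) b : uniq B -> cyl f ->
  mean (fun w => (allis B b w)%:R * f w) =
  mean (fun w => f (setcfg B b w)) / 2 ^+ size B.
Proof.
move=> uB cf.
have [L [uL gL fL]] := cyl_list2 (cyl_allis B b) cf.
pose L' := undup (B ++ L).
have sL e : e \in L -> e \in L' by rewrite mem_undup mem_cat => ->; rewrite orbT.
have sB e : e \in B -> e \in L' by rewrite mem_undup mem_cat => ->.
have uL' : uniq L' by rewrite undup_uniq.
have gL' := depends_sub sL gL; have fL' := depends_sub sL fL.
rewrite (meanE w0 uL' (depends_comp2 _ gL' fL')).
have sf : depends (fun w => f (setcfg B b w)) (fun e => e \in L').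
  move=> w w' ww'; apply: fL' => e eL'; rewrite /setcfg.
  by case: ifP => // _; apply: ww'.
rewrite (meanE w0 uL' sf).
pose D := [seq e <- L' | e \notin B].
have pL : perm_eq L' (D ++ B).
  rewrite perm_sym; have /permPl h := perm_filterC (fun e => e \notin B) L'.
  apply: perm_trans (h); rewrite perm_cat2l; apply: uniq_perm; rewrite ?filter_uniq // => e.
  rewrite mem_filter /= negbK; case eB: (e \in B) => //=; by rewrite sB.
rewrite !(perm_avg _ _ pL) !avg_cat -[RHS]mulrC -avgZ; apply: eq_avg => w.
rewrite avg_setcfg // mulrC; congr (_ * _).
rewrite (@avg_out _ _ B (fun w => f (setcfg B b w)) (fun e => e \notin B)) //.
  by move=> v v' vv'; congr f; apply/funext => e; rewrite /setcfg; case: ifP => // /negbT /vv'.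
by move=> e ->.
Qed.

Lemma mean_map f (t s : U -> U) : cancel t s -> cancel s t -> cyl f ->
  cyl (fun w => f (w \o t)) /\ mean (fun w => f (w \o t)) = mean f.
Proof.
move=> ts st cf; have [L uL fL] := cyl_list cf.
have uM : uniq (map t L) by rewrite map_inj_uniq //; exact: can_inj ts.
have fM : depends (fun w => f (w \o t)) (fun e => e \in map t L).
  by move=> w w' ww'; apply: fL => e eL /=; apply: ww'; rewrite map_f.
split; first by exists (map t L).
rewrite (meanE w0 uL fL) (meanE w0 uM fM).
have gen (L1 : seq U) w : avg (map t L1) (fun w => f (w \o t)) w = avg L1 f (w \o t).
  elim: L1 w => //= e L1 IH w; rewrite !IH.
  have E b : upd w (t e) b \o t = upd (w \o t) e b.
    by apply/funext => x; rewrite /= /upd (inj_eq (can_inj ts)).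
  by rewrite !E.
by rewrite gen.
Qed.

(** Fair coins are invariant under adding a fixed configuration. This serves for exchanging open and
    closed bonds as well as for flipping all spins, or those of one cluster. *)
Lemma mean_flip f (c : U -> bool) : cyl f ->
  cyl (fun w => f (fun e => c e (+) w e)) /\ mean (fun w => f (fun e => c e (+) w e)) = mean f.
Proof.
move=> cf; have [L uL fL] := cyl_list cf.
have fN : depends (fun w => f (fun e => c e (+) w e)) (fun e => e \in L).
  by move=> w w' ww'; apply: fL => e eL /=; rewrite ww'.
split; first by exists L.
rewrite (meanE w0 uL fN) (meanE (fun e => c e (+) w0 e) uL fL).
elim: (L) (w0) => //= e L1 IH w.
have E b : (fun x => c x (+) upd w e b x) = upd (fun x => c x (+) w x) e (c e (+) b).
  by apply/funext => x; rewrite /upd; case: eqP => // ->.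
by rewrite !IH !E; case: (c e) => //=; rewrite addrC.
Qed.

Definition ind A w : R := (`[< A w >])%:R.
Definition pr A : R := mean (ind A).

Lemma ind_cyl A : cyl A -> cyl (ind A).
Proof. by move=> cA; apply: (cyl_comp (fun P : Prop => (`[< P >])%:R : R) cA). Qed.

Lemma ind_ge0 A w : 0 <= ind A w. Proof. by rewrite ler0n. Qed.
Lemma ind_le1 A w : ind A w <= 1. Proof. by rewrite /ind; case: asboolP. Qed.

Lemma indT A w : A w -> ind A w = 1. Proof. by rewrite /ind; case: asboolP. Qed.
Lemma indF A w : ~ A w -> ind A w = 0. Proof. by rewrite /ind; case: asboolP. Qed.

Lemma le_pr A B : cyl A -> cyl B -> (forall w, A w -> B w) -> pr A <= pr B.
Proof.
move=> cA cB AB; apply: le_mean; rewrite ?ind_cyl //; try exact: ind_cyl.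
move=> w; have [Aw|nA] := pselect (A w); first by rewrite !indT //; apply: AB.
by rewrite (indF nA) ind_ge0.
Qed.

Lemma pr_ge0 A : cyl A -> 0 <= pr A.
Proof.
move=> cA; rewrite -(mean_cst 0); apply: le_mean (ind_ge0 A); last exact: ind_cyl.
exact: cyl_cst.
Qed.

Lemma pr_le1 A : cyl A -> pr A <= 1.
Proof.
move=> cA; rewrite -(mean_cst 1); apply: le_mean (ind_le1 A); first exact: ind_cyl.
exact: cyl_cst.
Qed.

Lemma cylI A B : cyl A -> cyl B -> cyl (fun w => A w /\ B w).
Proof. exact: cyl_comp2. Qed.

Lemma cylN A : cyl A -> cyl (fun w => ~ A w).
Proof. exact: cyl_comp. Qed.

Lemma prN A : cyl A -> pr (fun w => ~ A w) = 1 - pr A.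
Proof.
move=> cA; rewrite -[in RHS](mean_cst 1) -meanB; [|exact: cyl_cst|exact: ind_cyl].
congr mean; apply/funext => w; have [Aw|nA] := pselect (A w).
  by rewrite (indT Aw) subrr indF //; case.
by rewrite (indF nA) subr0 indT.
Qed.

Lemma prI_ge A B : cyl A -> cyl B -> pr A + pr B - 1 <= pr (fun w => A w /\ B w).
Proof.
move=> cA cB; rewrite -(mean_cst 1) -meanD; [|exact: ind_cyl..].
rewrite -meanB; [|apply: (cyl_comp2 (fun x y => x + y)); exact: ind_cyl|exact: cyl_cst].
apply: le_mean => [||w].
- apply: (cyl_comp2 (fun x y => x - y)); last exact: cyl_cst.
  by apply: (cyl_comp2 (fun x y => x + y)); exact: ind_cyl.
- exact/ind_cyl/cylI.
have [Aw|nA] := pselect (A w).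
  rewrite (indT Aw); have [Bw|nB] := pselect (B w); first by rewrite !indT // addrK.
  by rewrite (indF nB) addr0 subrr ind_ge0.
by rewrite (indF nA) add0r; apply: le_trans (ind_ge0 _ _); rewrite subr_le0 ind_le1.
Qed.

Definition antitone A := forall w w' : U -> bool, le_cfg w w' -> A w' -> A w.

Lemma antitoneI A B : antitone A -> antitone B -> antitone (fun w => A w /\ B w).
Proof. by move=> aA aB w w' ww' [/(aA _ _ ww') ? /(aB _ _ ww')]. Qed.

Lemma pr_FKG A B : cyl A -> cyl B -> antitone A -> antitone B ->
  pr A * pr B <= pr (fun w => A w /\ B w).
Proof.
move=> cA cB aA aB.
(* The negated indicator of a decreasing event is increasing, and the two signs cancel in the
   product. *)
have aN C : antitone C -> increasing (fun w => - 1 * ind C w).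
  move=> aC w w' ww'; rewrite !mulN1r lerN2.
  have [Cw|nC] := pselect (C w'); last by rewrite (indF nC) ind_ge0.
  by rewrite !indT //; apply: aC Cw.
have cN C : cyl C -> cyl (fun w => - 1 * ind C w).
  by move=> cC; apply: (cyl_comp _ (ind_cyl cC)).
have := mean_FKG (cN _ cA) (cN _ cB) (aN _ aA) (aN _ aB).
rewrite !meanZ; [|exact: ind_cyl..].
rewrite mulrACA mulrNN !mul1r => h; apply: le_trans h _.
rewrite le_eqVlt; apply/orP; left; apply/eqP; congr mean; apply/funext => w.
by rewrite mulrACA mulrNN !mul1r /ind asbool_and -natrM mulnb.
Qed.

Lemma pr_allisI A (B : seq U) b : uniq B -> cyl A ->
  depends A (fun e => e \notin B) ->
  pr (fun w => allis B b w /\ A w) = pr A / 2 ^+ size B.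
Proof.
move=> uB cA dA.
have -> : pr (fun w => allis B b w /\ A w) = mean (fun w => (allis B b w)%:R * ind A w).
  congr mean; apply/funext => w; by rewrite /ind asbool_and -natrM mulnb asboolb.
rewrite mean_allis //; last exact: ind_cyl.
congr (mean _ / _); apply/funext => w; congr (nat_of_bool `[< _ >])%:R.
by apply: dA => e eB; rewrite /setcfg (negPf eB).
Qed.

End Mean.
Arguments ind {R U}.

(** * Bond percolation on the square lattice *)

(* An undirected edge of Z^2 is its lower-left end together with a direction,
   [true] for vertical. *)
Notation site := (int * int)%type.
Notation bond := (int * int * bool)%type.

Definition far_end (e : bond) : site :=
  if e.2 then (e.1.1, e.1.2 + 1) else (e.1.1 + 1, e.1.2).

Definition joins (e : bond) (u v : site) :=
  (u = e.1 /\ v = far_end e) \/ (v = e.1 /\ u = far_end e).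

Definition inside (A : site -> Prop) (e : bond) := A e.1 /\ A (far_end e).

Inductive conn (S : bond -> Prop) (w : bond -> bool) (u : site) : site -> Prop :=
| conn_refl : conn S w u u
| conn_step v e v' : conn S w u v -> S e -> w e -> joins e v v' -> conn S w u v'.

Lemma joins_sym e u v : joins e u v -> joins e v u.
Proof. by case=> [[-> ->]|[-> ->]]; [right|left]. Qed.

Lemma conn_trans S w u v x : conn S w u v -> conn S w v x -> conn S w u x.
Proof. by move=> uv; elim=> // y e y' _ IH Se we j; apply: conn_step IH Se we j. Qed.

Lemma conn_sym S w u v : conn S w u v -> conn S w v u.
Proof.
elim=> [|y e y' _ IH Se we /joins_sym j]; first exact: conn_refl.
apply: conn_trans IH; apply: conn_step Se we j; exact: conn_refl.
Qed.

Lemma conn_sub (S S' : bond -> Prop) (w w' : bond -> bool) u v :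
  (forall e, S e -> w e -> S' e /\ w' e) -> conn S w u v -> conn S' w' u v.
Proof.
move=> h; elim=> [|y e y' _ IH Se we j]; first exact: conn_refl.
by have [? ?] := h _ Se we; apply: conn_step IH _ _ j.
Qed.

Lemma conn_map (t : bond -> bond) (f : site -> site) (S S' : bond -> Prop) w u v :
  (forall e u v, joins e u v -> joins (t e) (f u) (f v)) ->
  (forall e, S e -> S' (t e)) ->
  conn S (w \o t) u v -> conn S' w (f u) (f v).
Proof.
move=> tj ts; elim=> [|y e y' _ IH Se we j]; first exact: conn_refl.
by apply: conn_step IH (ts _ Se) we (tj _ _ _ j).
Qed.

Lemma joins_inside (A : site -> Prop) e u v : joins e u v -> A u -> A v -> inside A e.
Proof. by case=> [[-> ->]|[-> ->]]; split. Qed.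

Lemma inside_joins (A : site -> Prop) e u v : joins e u v -> inside A e -> A u /\ A v.
Proof. by case=> [[-> ->]|[-> ->]] []; split. Qed.

Definition exits (A : site -> Prop) (S : bond -> Prop) w u := exists v e v',
  [/\ conn (inside A) w u v, S e, w e, joins e v v' & A v /\ ~ A v'].

(** Follow the path up to its first step out of [A]. *)
Lemma conn_exits (A : site -> Prop) S w u v : A u -> conn S w u v ->
  (A v /\ conn (inside A) w u v) \/ exits A S w u.
Proof.
move=> Au; elim=> [|y e y' _ [[Ay uy]|ex] Se we j]; last by right.
  by left; split => //; exact: conn_refl.
have [Ay'|nA] := pselect (A y'); last by right; exists y, e, y'.
by left; split => //; exact: conn_step uy (joins_inside j Ay Ay') we j.
Qed.

(** * Finite sets of bonds, rectangles and reflections *)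

Definition rng (x : int) (m : nat) : seq int := [seq x + i%:Z | i <- iota 0 m].

Lemma mem_rng x m y : (y \in rng x m) = (x <= y < x + m%:Z).
Proof.
apply/mapP/idP => [[i]|h]; first by rewrite mem_iota => ? ->; lia.
exists `|(y - x)%R|%N; [rewrite mem_iota|]; lia.
Qed.

Lemma uniq_rng x m : uniq (rng x m).
Proof. by rewrite map_inj_uniq ?iota_uniq //; move=> i k /= xik; lia. Qed.

Definition block (x y : int) (m m' : nat) : seq bond :=
  [seq (p, b) | p <- [seq (i, j) | i <- rng x m, j <- rng y m'], b <- [:: true; false]].

Lemma mem_block x y m m' (e : bond) :
  (e \in block x y m m') = (x <= e.1.1 < x + m%:Z) && (y <= e.1.2 < y + m'%:Z).
Proof.
case: e => [[i j] b] /=; rewrite -!mem_rng; apply/allpairsP/andP.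
  by case=> -[[i' j'] b'] /= [/allpairsP[[i1 j1] /= [ir jr [-> ->]]] _ [-> -> _]].
case=> ir jr; exists ((i, j), b) => /=; split => //; last by case: b.
by apply/allpairsP; exists (i, j).
Qed.

Lemma uniq_block x y m m' : uniq (block x y m m').
Proof.
apply: allpairs_uniq => //; last by move=> [? ?] [? ?] _ _ /= [-> ->].
by apply: allpairs_uniq; rewrite ?uniq_rng // => -[? ?] [? ?] _ _ /= [-> ->].
Qed.

Lemma size_block x y m m' : size (block x y m m') = (m * m' * 2)%N.
Proof. by rewrite !size_allpairs /rng !size_map !size_iota. Qed.

Definition hcol (x : int) (h : nat) : seq bond :=
  [seq ((x, y), false) | y <- rng (- h%:Z) (2 * h + 1)].

Lemma mem_hcol x h (e : bond) :
  (e \in hcol x h) = [&& ~~ e.2, e.1.1 == x & - h%:Z <= e.1.2 <= h%:Z].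
Proof.
apply/mapP/idP => [[y]|]; first by rewrite mem_rng => ? -> /=; rewrite eqxx; lia.
case: e => [[i j] []] //= /andP[/eqP -> h1]; exists j => //; rewrite mem_rng; lia.
Qed.

Definition vrow (y : int) (a : nat) : seq bond :=
  [seq ((x, y), true) | x <- rng (- a%:Z) (2 * a + 1)].

Lemma mem_vrow y a (e : bond) :
  (e \in vrow y a) = [&& e.2, e.1.2 == y & - a%:Z <= e.1.1 <= a%:Z].
Proof.
apply/mapP/idP => [[x]|]; first by rewrite mem_rng => ? -> /=; rewrite eqxx; lia.
case: e => [[i j] []] //= /andP[/eqP -> h1]; exists i => //; rewrite mem_rng; lia.
Qed.

Lemma uniq_hcol x h : uniq (hcol x h).
Proof. by rewrite map_inj_uniq ?uniq_rng // => ? ? []. Qed.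

Lemma uniq_vrow y a : uniq (vrow y a).
Proof. by rewrite map_inj_uniq ?uniq_rng // => ? ? []. Qed.

Lemma size_hcol x h : size (hcol x h) = (2 * h + 1)%N.
Proof. by rewrite /hcol /rng !size_map size_iota. Qed.

Lemma size_vrow y a : size (vrow y a) = (2 * a + 1)%N.
Proof. by rewrite /vrow /rng !size_map size_iota. Qed.

Definition rect (a h : nat) (v : site) :=
  (- a%:Z <= v.1 <= a%:Z) /\ (- h%:Z <= v.2 <= h%:Z).

Lemma cyl_inside T (f : (bond -> bool) -> T) a h :
  depends f (inside (rect a h)) -> cyl f.
Proof.
move=> df; exists (block (- a%:Z) (- h%:Z) (2 * a + 1) (2 * h + 1)).
by apply: depends_sub df => e [[? ?] _]; rewrite mem_block; lia.
Qed.

Definition flipx (e : bond) : bond :=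
  if e.2 then ((- e.1.1, e.1.2), true) else ((- e.1.1 - 1, e.1.2), false).
Definition flipy (e : bond) : bond :=
  if e.2 then ((e.1.1, - e.1.2 - 1), true) else ((e.1.1, - e.1.2), false).

Lemma flipxK : involutive flipx.
Proof. by move=> [[x y] []] /=; rewrite /flipx /=; congr (_, _, _); lia. Qed.
Lemma flipyK : involutive flipy.
Proof. by move=> [[x y] []] /=; rewrite /flipy /=; congr (_, _, _); lia. Qed.

Lemma joins_flipx e u v : joins e u v ->
  joins (flipx e) (- u.1, u.2) (- v.1, v.2).
Proof.
case: e => [[x y] []]; rewrite /flipx /joins /far_end /=.
  by case=> [[-> ->]|[-> ->]]; [left|right]; split.
by case=> [[-> ->]|[-> ->]]; [right|left]; split => //=; congr (_, _); lia.
Qed.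

Lemma joins_flipy e u v : joins e u v ->
  joins (flipy e) (u.1, - u.2) (v.1, - v.2).
Proof.
case: e => [[x y] []]; rewrite /flipy /joins /far_end /=; last first.
  by case=> [[-> ->]|[-> ->]]; [left|right]; split.
by case=> [[-> ->]|[-> ->]]; [right|left]; split => //=; congr (_, _); lia.
Qed.

Lemma inside_flipx a h e : inside (rect a h) e -> inside (rect a h) (flipx e).
Proof.
by case: e => [[x y] []]; rewrite /flipx /inside /far_end /rect /= => -[[? ?] [? ?]]; do !split; lia.
Qed.

Lemma inside_flipy a h e : inside (rect a h) e -> inside (rect a h) (flipy e).
Proof.
by case: e => [[x y] []]; rewrite /flipy /inside /far_end /rect /= => -[[? ?] [? ?]]; do !split; lia.
Qed.

(** The open bond leaving the rectangle at [(x, h)] belongs to the arm. Closing a row of such bonds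
    thus blocks the exits there without touching the configuration inside. *)
Definition up_arm (n a h : nat) (X : int -> Prop) (w : bond -> bool) :=
  exists u x, [/\ rect n n u, X x /\ - a%:Z <= x <= a%:Z, conn (inside (rect a h)) w u (x, h%:Z)
    & w ((x, h%:Z), true)].

Definition box_exits (n a h : nat) (w : bond -> bool) :=
  exists2 u, rect n n u & exits (rect a h) (fun=> True) w u.

Definition column_arm (n a h : nat) (w : bond -> bool) :=
  exists u v, [/\ rect n n u, conn (inside (rect a h)) w u v
    & v.1 = a%:Z \/ v.1 = - a%:Z].

Lemma up_arm_depends n a h X : depends (up_arm n a h X)
  (fun e => inside (rect a h) e \/ exists2 x, X x /\ - a%:Z <= x <= a%:Z & e = ((x, h%:Z), true)).
Proof.
move=> w w' ww'; apply/propext; split=> -[u [x [nu Xx uv wx]]]; exists u, x; split => //.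
- by move: uv; apply: conn_sub => e i; rewrite ww' //; left.
- by rewrite -ww' //; right; exists x.
- by move: uv; apply: conn_sub => e i; rewrite ww' //; left.
- by rewrite ww' //; right; exists x.
Qed.

Lemma box_exits_depends n a h : depends (box_exits n a h) (inside (rect a.+1 h.+1)).
Proof.
have sub e : inside (rect a h) e -> inside (rect a.+1 h.+1) e.
  by rewrite /inside /rect => -[[? ?] [? ?]]; do !split; lia.
have sub2 e v v' : rect a h v -> joins e v v' -> inside (rect a.+1 h.+1) e.
  case: e => [[x y] []] [? ?]; rewrite /joins /inside /far_end /rect /=;
  by case=> -[? ?]; subst; simpl in *; do !split; lia.
have mono w w' : (forall e, inside (rect a.+1 h.+1) e -> w e = w' e) ->
    box_exits n a h w -> box_exits n a h w'.
  move=> ww' [u nu [v [e [v' [uv _ we j [rv nr]]]]]]; exists u => //; exists v, e, v'; split => //.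
    by move: uv; apply: conn_sub => f i; rewrite ww' //; exact: sub.
  by rewrite -ww' //; exact: sub2 rv j.
by move=> w w' ww'; apply/propext; split; apply: mono => e /ww'.
Qed.

Lemma column_arm_depends n a h : depends (column_arm n a h) (inside (rect a h)).
Proof.
have mono w w' : (forall e, inside (rect a h) e -> w e = w' e) ->
    column_arm n a h w -> column_arm n a h w'.
  move=> ww' [u [v [nu uv e]]]; exists u, v; split => //.
  by move: uv; apply: conn_sub => f i; rewrite ww'.
by move=> w w' ww'; apply/propext; split; apply: mono => e /ww'.
Qed.

Lemma cyl_up_arm n a h X : cyl (up_arm n a h X).
Proof.
apply: (@cyl_inside _ _ a.+1 h.+1); apply: depends_sub (@up_arm_depends n a h X) => e.
case=> [[[? ?] [? ?]]|[x [_ ?] ->]]; first by do !split; lia.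
by do !split => /=; lia.
Qed.

Lemma cyl_box_exits n a h : cyl (box_exits n a h).
Proof. exact: cyl_inside (@box_exits_depends n a h). Qed.

Lemma cyl_column_arm n a h : cyl (column_arm n a h).
Proof. exact: cyl_inside (@column_arm_depends n a h). Qed.

Lemma box_exits_antitone n a h a' h' w : (n <= a)%N -> (n <= h)%N -> (a <= a')%N ->
  (h <= h')%N -> box_exits n a' h' w -> box_exits n a h w.
Proof.
move=> na nh aa hh [u nu [v [e [v' [uv _ we j [rv nr]]]]]]; exists u => //.
have ru : rect a h u by move: nu; rewrite /rect; lia.
have uv' : conn (fun=> True) w u v' by apply: conn_step we j => //; move: uv; apply: conn_sub.
have [[rv' _]|//] := conn_exits ru uv'.
by case: nr; move: rv'; rewrite /rect; lia.
Qed.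

(** A longer arm passes the column at distance [a] and uses a horizontal bond just beyond it.
    [column_arm n a h] does not read these bonds, so each further column is a fresh chance to block
    the arm. *)
Lemma column_arm_step n a h w : (n <= a)%N -> (n <= h)%N ->
  column_arm n a.+1 h w ->
  column_arm n a h w /\
  exists2 e, e \in hcol (- a%:Z - 1) h ++ hcol a%:Z h & w e.
Proof.
move=> na nh [u [v [nu uv ve]]].
have ru : rect a h u by move: nu; rewrite /rect; lia.
have [[rv _]|] := conn_exits ru uv; first by move: rv; rewrite /rect; lia.
move=> [y [e [y' [uy ie we j [ry nr]]]]].
have [_ ry'] := inside_joins j ie.
have [ye ee] : (y.1 = a%:Z \/ y.1 = - a%:Z) /\ e \in hcol (- a%:Z - 1) h ++ hcol a%:Z h.
  rewrite mem_cat !mem_hcol; move: ry nr ry' j; rewrite /joins /far_end /rect.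
  by case: e {we ie} => [[p q] []]; case: y {uy} => y1 y2; case: y' => y1' y2' /=;
    move=> ? ? ? [[[? ?] [? ?]]|[[? ?] [? ?]]]; split; lia.
by split; [exists u, y|exists e].
Qed.

Lemma box_exits_cases n a h w : (n <= a)%N -> (n <= h)%N -> box_exits n a h w ->
  [\/ column_arm n a h w, exists2 x, up_arm n a h (eq x) w & w ((x, h%:Z), true) |
      exists2 x, up_arm n a h (eq x) (w \o flipy) & w ((x, - h%:Z - 1), true)].
Proof.
move=> na nh [u nu [v [e [v' [uv _ we j [rv nr]]]]]].
case ed : e.2; last first.
  constructor 1; exists u, v; split => //.
  move: rv nr j; rewrite /joins /far_end ed /rect.
  by case: e {we} ed => [[p q] b]; case: v {uv} => y1 y2; case: v' => y1' y2' /=;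
    move=> _ ? ? [[[? ?] [? ?]]|[[? ?] [? ?]]]; lia.
have [[vh eE]|[vh eE]] : (v.2 = h%:Z /\ e = ((v.1, h%:Z), true)) \/
    (v.2 = - h%:Z /\ e = ((v.1, - h%:Z - 1), true)).
  move: rv nr j; rewrite /joins /far_end ed /rect.
  case: e {we} ed => [[p q] b]; case: v {uv} => y1 y2; case: v' => y1' y2' /= ->.
  move=> ? ? [[[? ?] [? ?]]|[[? ?] [? ?]]]; [left|right]; subst; split; (try congr (_, _, _)); lia.
- constructor 2; exists v.1; last by rewrite -eE.
  exists u, v.1; split => //; first by case: rv.
    by rewrite -vh -surjective_pairing.
  by rewrite -eE.
- constructor 3; exists v.1; last by rewrite -eE.
  exists (u.1, - u.2), v.1; split => //; first by move: nu; rewrite /rect /=; lia.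
  + by split => //; case: rv.
  + have -> : (v.1, h%:Z) = (v.1, - v.2) by rewrite vh opprK.
    apply: (conn_map joins_flipy (S := inside (rect a h))); first exact: inside_flipy.
    by move: uv; rewrite (_ : w \o flipy \o flipy = w) //; apply/funext => x /=; rewrite flipyK.
  + by rewrite /= /flipy /= -eE.
Qed.

Lemma up_arm_sub n a h (X Y : int -> Prop) w :
  (forall x, X x -> Y x) -> up_arm n a h X w -> up_arm n a h Y w.
Proof. by move=> XY [u [x [? [/XY ? ?] ? ?]]]; exists u, x. Qed.

Lemma up_arm_flipx n a h (X : int -> Prop) w :
  up_arm n a h X (w \o flipx) -> up_arm n a h (fun x => X (- x)) w.
Proof.
move=> [u [x [nu [Xx xa] ux wx]]]; exists (- u.1, u.2), (- x); split.
- by move: nu; rewrite /rect /=; lia.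
- by rewrite opprK; split => //; lia.
- by have := conn_map joins_flipx (@inside_flipx a h) ux.
- by move: wx; rewrite /= /flipx.
Qed.

Lemma conn_le S u v (w w' : bond -> bool) : le_cfg w w' -> conn S w u v -> conn S w' u v.
Proof. by move=> ww'; apply: conn_sub => e ? /ww'. Qed.

Lemma up_arm_le n a h X (w w' : bond -> bool) :
  le_cfg w w' -> up_arm n a h X w -> up_arm n a h X w'.
Proof.
by move=> ww' [u [x [? ? /(conn_le ww') ? /ww' ?]]]; exists u, x.
Qed.

Lemma up_arm_right n a h (J : int) :
  up_arm n a h (fun x => J < x) = fun w => up_arm n a h (fun x => x < - J) (w \o flipx).
Proof.
apply/funext => w; apply/propext; split => [t|/up_arm_flipx]; last first.
  by apply: up_arm_sub => x; lia.
apply: (@up_arm_sub _ _ _ (fun x => J < - x)); first by move=> x; lia.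
apply: (@up_arm_flipx n a h (fun x => J < x)); rewrite (_ : _ \o flipx = w) //.
by apply/funext => e /=; rewrite flipxK.
Qed.

(** * Probabilities of arms *)

Section Arms.
Variable R : realType.

Lemma geometric_small (q d : R) : 0 <= q < 1 -> 0 < d -> exists k, q ^+ k <= d.
Proof.
move=> /andP[q0 q1] d0.
(* Bernoulli's inequality in multiplied-out form. *)
have bern k : q ^+ k * (1 + k%:R * (1 - q)) <= 1.
  elim: k => [|k IH]; first by rewrite expr0 mul1r mul0r addr0.
  apply: le_trans IH; rewrite exprS -mulrA mulrCA; apply: ler_wpM2l; first exact: exprn_ge0.
  have : 0 <= (k%:R + 1) * (1 - q) ^+ 2 by rewrite mulr_ge0 ?sqr_ge0 // addr_ge0 // ler0n.
  by rewrite -natr1 => h; rewrite -subr_ge0; apply: le_trans h _; rewrite le_eqVlt; apply/orP; left; apply/eqP; ring.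
have D : 0 < d * (1 - q) by rewrite mulr_gt0 // subr_gt0.
pose k := Num.bound ((d * (1 - q))^-1); exists k.
have : (d * (1 - q))^-1 < k%:R by apply: archi_boundP; rewrite invr_ge0 ltW.
rewrite -[_^-1]mul1r ltr_pdivrMr // => h; rewrite leNgt; apply/negP => dq.
have := bern k; apply/negP; rewrite -ltNge; apply: lt_trans h _; rewrite mulrCA.
have : 0 <= k%:R * (1 - q) by rewrite mulr_ge0 ?ler0n // subr_ge0 ltW.
set X := _ * (1 - q) => X0; apply: lt_trans (_ : d * (1 + X) < _).
  by rewrite mulrDr mulr1; lra.
by rewrite ltr_pM2r //; lra.
Qed.

(** If every index were followed by a further drop of more than [z], repeating the drop would make
    [u] negative. *)
Lemma nonincreasing_stable (u : nat -> R) (m : nat) (z : R) :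
  (forall i j, (m <= i)%N -> (i <= j)%N -> u j <= u i) -> (forall i, 0 <= u i) -> 0 < z ->
  exists2 N, (m <= N)%N & forall j, (N <= j)%N -> u N - u j <= z.
Proof.
move=> ui u0 z0; apply: contrapT => nex.
have drop k : exists2 i, (m <= i)%N & u i <= u m - k%:R * z.
  elim: k => [|k [i mi ui']]; first by exists m; rewrite // mul0r subr0.
  have [j ij uj] : exists2 j, (i <= j)%N & u j < u i - z.
    apply: contrapT => nj; apply: nex; exists i => // j ij; rewrite leNgt; apply/negP => h.
    by apply: nj; exists j => //; lra.
  by exists j; [exact: leq_trans ij|rewrite -natr1 mulrDl mul1r; lra].
have [i _] := drop (Num.bound (u m / z)).
have : u m / z < (Num.bound (u m / z))%:R by apply: archi_boundP; rewrite divr_ge0 // ltW.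
by rewrite ltr_pdivrMr // => ? ?; have := u0 i; lra.
Qed.

Notation pr := (@pr R bond).

Lemma pr_diff (A B : (bond -> bool) -> Prop) : cyl A -> cyl B -> (forall w, B w -> A w) ->
  pr (fun w => A w /\ ~ B w) = pr A - pr B.
Proof.
move=> cA cB BA; rewrite -meanB; [|exact: ind_cyl..]; congr mean; apply/funext => w.
have [Bw|nB] := pselect (B w); last first.
  rewrite (indF _ nB) subr0; have [Aw|nA] := pselect (A w); first by rewrite !indT.
  by rewrite !indF // => -[].
by rewrite (indT _ Bw) (indT _ (BA _ Bw)) subrr indF // => -[].
Qed.

Lemma uniq_cat_disjoint (T : eqType) (s1 s2 : seq T) : uniq s1 -> uniq s2 ->
  (forall x, x \in s1 -> x \in s2 -> False) -> uniq (s1 ++ s2).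
Proof.
move=> u1 u2 d; rewrite cat_uniq u1 u2 andbT /=; apply/hasPn => x x2; apply/negP => x1.
exact: d x1 x2.
Qed.

(** At fixed height, each further pair of columns is entirely closed with probability [2 ^- m],
    independently of the arm reaching it, so the decay in [a] is geometric. *)
Lemma column_arm_small n h (d : R) : (n <= h)%N -> 0 < d ->
  exists a0, forall a, (a0 <= a)%N -> pr (column_arm n a h) <= d.
Proof.
move=> nh d0.
pose B a := hcol (- a%:Z - 1) h ++ hcol a%:Z h.
have uB a : uniq (B a).
  by apply: uniq_cat_disjoint; rewrite ?uniq_hcol // => e; rewrite !mem_hcol; lia.
pose m := (2 * h + 1 + (2 * h + 1))%N.
have sB a : size (B a) = m by rewrite size_cat !size_hcol.
have p0 : 0 < (2 ^+ m : R)^-1 by rewrite invr_gt0 exprn_gt0.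
have p1 : (2 ^+ m : R)^-1 <= 1 by rewrite invf_le1 ?exprn_gt0 // exprn_ege1 // ler1n.
pose q : R := 1 - (2 ^+ m)^-1.
have q0 : 0 <= q by rewrite subr_ge0.
have mono a : (n <= a)%N -> pr (column_arm n a.+1 h) <= pr (column_arm n a h).
  move=> na; apply: le_pr; rewrite ?cyl_column_arm //; try exact: cyl_column_arm.
  by move=> w /(column_arm_step na nh)[].
have step a : (n <= a)%N -> pr (column_arm n a.+1 h) <= q * pr (column_arm n a h).
  move=> na.
  have dA : depends (column_arm n a h) (fun e => e \notin B a).
    apply: depends_sub (@column_arm_depends n a h) => e [[r1 _] [r2 _]].
    rewrite mem_cat !mem_hcol; move: r1 r2; rewrite /far_end; case: e.2 => //=; lia.
  have := pr_allisI R false (uB a) (cyl_column_arm n a h) dA; rewrite sB => E.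
  have cc : cyl (fun w => allis (B a) false w /\ column_arm n a h w).
    apply: cylI; last exact: cyl_column_arm.
    by exists (B a) => w w' ww'; congr is_true; apply: eq_in_all => e eB; rewrite ww'.
  rewrite mulrBl mul1r [_^-1 * _]mulrC -E -pr_diff //; [|exact: cyl_column_arm|by move=> w []].
  apply: le_pr; [exact: cyl_column_arm|apply: cylI; [exact: cyl_column_arm|exact: cylN]|].
  move=> w /(column_arm_step na nh)[ca [e eB we]]; split => // -[/allP/(_ e eB)].
  by rewrite we.
have [k qk] : exists k, q ^+ k <= d by apply: geometric_small => //; rewrite q0 /= /q ltrBlDr ltrDl.
have pow j : pr (column_arm n (n + j) h) <= q ^+ j.
  elim: j => [|j IH]; first by rewrite expr0; apply/pr_le1/cyl_column_arm.
  rewrite addnS exprS; apply: le_trans (step _ (leq_addr _ _)) _; exact: ler_wpM2l.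
exists (n + k)%N => a /subnKC <-; elim: (a - _)%N => [|j IH].
  by rewrite addn0; apply: le_trans (pow k) qk.
by rewrite addnS; apply: le_trans IH; apply: mono; rewrite -addnA leq_addr.
Qed.

Lemma depends_map (U : eqType) T (f : (U -> bool) -> T) (t : U -> U) S S' :
  (forall e, S e -> S' (t e)) -> depends f S -> depends (fun w => f (w \o t)) S'.
Proof. by move=> SS fS w w' ww'; apply: fS => e /SS /ww'. Qed.

Lemma pr_map (A : (bond -> bool) -> Prop) (t s : bond -> bond) :
  cancel t s -> cancel s t -> cyl A ->
  cyl (fun w => A (w \o t)) /\ pr (fun w => A (w \o t)) = pr A.
Proof.
move=> ts st cA; split; last exact: (mean_map ts st (ind_cyl R cA)).2.
have [L AL] := cA; exists (map t L); apply: depends_map AL => e eL.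
exact: map_f.
Qed.

Lemma pr_neg (A : (bond -> bool) -> Prop) : cyl A ->
  cyl (fun w => A (negb \o w)) /\ pr (fun w => A (negb \o w)) = pr A.
Proof.
move=> cA; split; last exact: (mean_flip (fun=> true) (ind_cyl R cA)).2.
by have [L AL] := cA; exists L => w w' ww'; apply: AL => e eL; rewrite /= ww'.
Qed.

Lemma le_sub_complement (x y d c : R) : x <= y -> d <= c -> x - c <= y + (1 - d) - 1.
Proof. lra. Qed.

Lemma fourth_power_bound (p : R) : (1 - p) ^+ 4 <= 3 * (2 ^+ 14)^-1 -> 7 / 8 <= p.
Proof.
move=> e4; rewrite leNgt; apply/negP => lt.
have : (1 / 8) ^+ 4 < (1 - p) ^+ 4 by rewrite ltrXn2r //; lra.
by lra.
Qed.

(* If the upward arm to the left of -J failed with probability eta, then by FKG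
   and symmetry, with probability about eta ^ 4, all exits would go through the
   2 (2 J + 1) bonds closest to the vertical axis. Closing these costs a factor
   that does not depend on the scale, and makes the box leave [rect N N] but
   not a larger rectangle, which is unlikely as the exit probability stabilises.
   The constant 2 ^ -14 ensures 3 * 2 ^ -14 < 8 ^ -4. *)
Lemma corner_arm_likely n J :
  (forall N, (n <= N)%N -> 1 - (2 ^+ 14)^-1 <= pr (box_exits n N N)) ->
  exists a h, [/\ (n <= a)%N, (n <= h)%N &
    7 / 8 <= pr (up_arm n a h (fun x => x < - J%:Z))].
Proof.
move=> hyp; pose m := (2 * J + 1 + (2 * J + 1))%N.
have m0 : 0 < 2 ^+ m :> R by rewrite exprn_gt0.
have [c cV] : exists c : R, c = (2 ^+ 14)^-1 by exists (2 ^+ 14)^-1.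
have c0 : 0 < c by rewrite cV invr_gt0 exprn_gt0.
have [|i||N nN stable] := @nonincreasing_stable (fun N => pr (box_exits n N N)) n (c / 2 ^+ m).
- move=> i j ni ij; apply: le_pr; [exact: cyl_box_exits..|].
  by move=> w; apply: box_exits_antitone => //; exact: leq_trans ij.
- exact/pr_ge0/cyl_box_exits.
- by rewrite divr_gt0.
(* One more than [N], so that leaving [rect N N] reads only bonds inside [rect a h], hence none of
   the bonds of [B] below. The width [a] is then taken large enough to make side exits unlikely. *)
pose h := N.+1; have nh : (n <= h)%N by exact: leqW.
have [a0 ha0] := column_arm_small nh c0.
pose a := (maxn a0 h); have na : (n <= a)%N by rewrite (leq_trans nh) // leq_maxr.
have ca := ha0 a (leq_maxl _ _).
exists a, h; split => //.
pose TL := up_arm n a h (fun x => x < - J%:Z).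
pose TR := up_arm n a h (fun x => J%:Z < x).
pose BL w := TL (w \o flipy); pose BR w := TR (w \o flipy).
have cTL : cyl TL by exact: cyl_up_arm.
have TRE : TR = fun w => TL (w \o flipx) by exact: up_arm_right.
have [cTR pTR] := pr_map flipxK flipxK cTL; rewrite -TRE in cTR pTR.
have [cBL pBL] := pr_map flipyK flipyK cTL; rewrite -/BL in cBL pBL.
have [cBR pBR] := pr_map flipyK flipyK cTR; rewrite -/BR in cBR pBR.
pose G w := ((~ TL w /\ ~ TR w) /\ (~ BL w /\ ~ BR w)) /\ ~ column_arm n a h w.
have cG : cyl G.
  by do !apply: cylI; apply: cylN => //; exact: cyl_column_arm.
have aT X : antitone (fun w => ~ up_arm n a h X w).
  by move=> w w' ww' nw /(up_arm_le ww').
have aB X : antitone (fun w => ~ up_arm n a h X (w \o flipy)).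
  by move=> w w' ww'; apply: aT => e /ww'.
pose eta := 1 - pr TL.
have Geta : eta ^+ 4 - c <= pr G.
  have e0 : 0 <= eta by rewrite subr_ge0 pr_le1.
  have h1 : eta ^+ 2 <= pr (fun w => ~ TL w /\ ~ TR w).
    have := pr_FKG R (cylN cTL) (cylN cTR) (aT _) (aT _).
    by rewrite !prN // pTR -expr2.
  have h2 : eta ^+ 2 <= pr (fun w => ~ BL w /\ ~ BR w).
    have := pr_FKG R (cylN cBL) (cylN cBR) (aB _) (aB _).
    by rewrite !prN // pBL pBR pTR -expr2.
  have h3 : eta ^+ 4 <= pr (fun w => (~ TL w /\ ~ TR w) /\ (~ BL w /\ ~ BR w)).
    have -> : eta ^+ 4 = eta ^+ 2 * eta ^+ 2 by rewrite -exprD.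
    apply: le_trans (pr_FKG _ _ _ _ _); try (by apply: cylI; apply: cylN);
      try (by apply: antitoneI => //; [exact: aT|exact: aT]);
      try (by apply: antitoneI => //; [exact: aB|exact: aB]).
    by apply: ler_pM => //; rewrite exprn_ge0.
  apply: le_trans (prI_ge _ _ _); [|by do !apply: cylI; apply: cylN|exact/cylN/cyl_column_arm].
  by rewrite prN; [exact: le_sub_complement|exact: cyl_column_arm].
pose B := vrow h%:Z J ++ vrow (- h%:Z - 1) J.
have uB : uniq B.
  by apply: uniq_cat_disjoint; rewrite ?uniq_vrow // => e; rewrite !mem_vrow; lia.
pose E w := G w /\ box_exits n N N w.
have cE : cyl E by apply: cylI => //; exact: cyl_box_exits.
have inB e : inside (rect a h) e -> e \notin B.
  move=> [[_ r1] [_ r2]]; rewrite mem_cat !mem_vrow; move: r1 r2; rewrite /far_end.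
  by case: e.2 => //=; lia.
have dTL : depends TL (fun e => e \notin B /\ flipy e \notin B).
  apply: depends_sub (@up_arm_depends n a h _) => e [i|[x [xJ _] ->]].
    by split; apply: inB => //; exact: inside_flipy.
  by rewrite /flipy /= !mem_cat !mem_vrow /=; split; lia.
have dTR : depends TR (fun e => e \notin B /\ flipy e \notin B).
  apply: depends_sub (@up_arm_depends n a h _) => e [i|[x [xJ _] ->]].
    by split; apply: inB => //; exact: inside_flipy.
  by rewrite /flipy /= !mem_cat !mem_vrow /=; split; lia.
have sub1 (A : (bond -> bool) -> Prop) : depends A (fun e => e \notin B /\ flipy e \notin B) ->
    depends A (fun e => e \notin B) /\ depends (fun w => A (w \o flipy)) (fun e => e \notin B).
  move=> dA; split; first by apply: depends_sub dA => e [].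
  by apply: depends_map dA => e [].
have [d1 d3] := sub1 _ dTL; have [d2 d4] := sub1 _ dTR.
have dE : depends E (fun e => e \notin B).
  have d5 : depends (column_arm n a h) (fun e => e \notin B).
    exact: depends_sub inB (@column_arm_depends n a h).
  have d6 : depends (box_exits n N N) (fun e => e \notin B).
    apply: depends_sub (@box_exits_depends n N N) => e [[? ?] [? ?]]; apply: inB.
    have : (N < a)%N by rewrite leq_max leqnn orbT.
    by move=> ?; do !split; rewrite /h; lia.
  move=> w w' ww'; rewrite /E /G /BL /BR.
  by rewrite (d1 w w') // (d2 w w') // (d3 w w') // (d4 w w') // (d5 w w') // (d6 w w').
have PE : eta ^+ 4 - c - c <= pr E.
  apply: le_trans (prI_ge _ cG (cyl_box_exits n N N)).
  have := hyp N nN; rewrite -cV; move: Geta; move: (pr G) (pr _) (eta ^+ 4) => g b e.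
  by clear; lra.
have sB : size B = m by rewrite size_cat !size_vrow.
have := pr_allisI R false uB cE dE; rewrite sB => EB.
(* On [E] with [B] closed there is no way out of [rect a h], hence none out of [rect a a]. Leaving
   [rect N N] but not [rect a a] has probability at most [c / 2 ^+ m] by stability, and the cost of
   closing [B] cancels the denominator. *)
have EN : pr E / 2 ^+ m <= c / 2 ^+ m.
  rewrite -EB; apply: le_trans (stable a _); last by rewrite (leq_trans _ (leq_maxr _ _)).
  rewrite -pr_diff; [|exact: cyl_box_exits..|]; last first.
    by move=> w; apply: box_exits_antitone => //; rewrite /a leq_max leqnSn orbT.
  apply: le_pr.
  - apply: cylI => //; exists B => w w' ww'; congr is_true.
    by apply: eq_in_all => e eB; rewrite ww'.
  - by apply: cylI; [|apply: cylN]; exact: cyl_box_exits.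
  move=> w [/allP cl [[[[nTL nTR] [nBL nBR]] nc] ex]]; split => // ex'.
  have {ex'} : box_exits n a h w by apply: box_exits_antitone ex' => //; exact: leq_maxr.
  case/(box_exits_cases na nh) => // -[x ux wx].
    have [xJ|] := boolP (x < - J%:Z); first by apply: nTL; apply: up_arm_sub ux => y <-.
    have [xJ|x1 x2] := boolP (J%:Z < x); first by case: nTR; apply: up_arm_sub ux => y <-.
    have := cl ((x, h%:Z), true); rewrite mem_cat !mem_vrow /= wx eqxx /=.
    by move=> h1; have : false by apply: h1; lia.
  have [xJ|] := boolP (x < - J%:Z); first by apply: nBL; apply: up_arm_sub ux => y <-.
  have [xJ|x1 x2] := boolP (J%:Z < x); first by case: nBR; apply: up_arm_sub ux => y <-.
  have := cl ((x, - h%:Z - 1), true); rewrite mem_cat !mem_vrow /= wx eqxx /=.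
  by move=> h1; have : false by apply: h1; lia.
move: EN; rewrite ler_pM2r ?invr_gt0 // => EN.
apply: fourth_power_bound; rewrite -/TL -cV -/eta; move: PE EN.
by move: (pr E) (eta ^+ 4) => g e; clear; lra.
Qed.

End Arms.

(** * Harris' theorem *)

Section Influence.
Variables (R : realType) (U : eqType).

(* Bessel's inequality: the functions [chi i] are orthogonal because the blocks
   are disjoint, while the increment of [A] on block i is its correlation
   with [chi i]. *)
Lemma block_influence_bound (K s : nat) (B : nat -> seq U) (A : (U -> bool) -> Prop) :
  (forall i, uniq (B i)) -> (forall i, size (B i) = s) ->
  (forall i k e, i != k -> e \in B i -> e \notin B k) -> cyl A ->
  (forall i, (i < K)%N ->
     1 / 2 <= pr R (fun w => A (setcfg (B i) true w)) -
              pr R (fun w => A (setcfg (B i) false w))) ->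
  K%:R <= 8 * 2 ^+ s :> R.
Proof.
move=> uB sB dB cA infl.
have P0 : 0 < 2 ^+ s :> R by rewrite exprn_gt0.
pose al i b w : R := (allis (B i) b w)%:R.
have cal i b : cyl (al i b) by exact: cyl_allis.
(* Scaled so that its mean against [f] is the difference of the means of [f] with block i forced
   open and forced closed. *)
pose chi i w : R := 2 ^+ s * (al i true w - al i false w).
have cchi i : cyl (chi i).
  apply: (cyl_comp (fun x : R => 2 ^+ s * x)).
  exact: (cyl_comp2 (fun x y : R => x - y)).
have mal i b f : cyl f -> mean (fun w => al i b w * f w) =
    mean (fun w => f (setcfg (B i) b w)) / 2 ^+ s.
  by move=> cf; rewrite mean_allis ?sB.
have mchi i f : cyl f -> mean (fun w => chi i w * f w) =
    mean (fun w => f (setcfg (B i) true w)) - mean (fun w => f (setcfg (B i) false w)).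
  move=> cf; have cM b : cyl (fun w => al i b w * f w).
    exact: (cyl_comp2 (fun x y : R => x * y)).
  have -> : (fun w => chi i w * f w) =
      (fun w => 2 ^+ s * (al i true w * f w - al i false w * f w)).
    by apply/funext => w; rewrite /chi -mulrA mulrBl.
  rewrite meanZ; last exact: (cyl_comp2 (fun x y : R => x - y)).
  by rewrite meanB // !mal // -mulrBl mulrCA divff ?mulr1 // gt_eqF.
have mchi0 i : mean (chi i) = 0.
  have := mchi i (fun=> 1) (cyl_cst _ _); rewrite subrr => <-.
  by congr mean; apply/funext => w; rewrite mulr1.
have orth i k : i != k -> mean (fun w => chi i w * chi k w) = 0.
  move=> ik; rewrite mchi //.
  suff E b : mean (fun w => chi k (setcfg (B i) b w)) = 0 by rewrite !E subrr.
  rewrite -[RHS](mchi0 k); congr mean; apply/funext => w; rewrite /chi /al.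
  suff E c : allis (B k) c (setcfg (B i) b w) = allis (B k) c w by rewrite !E.
  apply: eq_in_all => e ek; rewrite /setcfg ifN //.
  by apply: dB ek; rewrite eq_sym.
have sq i : mean (fun w => chi i w * chi i w) <= 2 * 2 ^+ s.
  have E : mean (fun w => 2 ^+ s * (2 ^+ s * (al i true w * 1 + al i false w * 1))) = 2 * 2 ^+ s.
    have c1 b : cyl (fun w => al i b w * 1) by apply: (cyl_comp (fun x : R => x * 1)).
    have c2 : cyl (fun w => al i true w * 1 + al i false w * 1).
      exact: (cyl_comp2 (fun x y : R => x + y)).
    rewrite meanZ; last exact: (cyl_comp (fun x : R => 2 ^+ s * x)).
    rewrite meanZ // meanD //; rewrite !(mal _ _ _ (cyl_cst _ _)) !mean_cst.
    by field; rewrite gt_eqF.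
  rewrite -E; apply: le_mean.
  - exact: (cyl_comp2 (fun x y : R => x * y)).
  - apply: (cyl_comp2 (fun x y : R => 2 ^+ s * (2 ^+ s * (x * 1 + y * 1)))); exact: cal.
  move=> w; rewrite /chi mulrACA -mulrA; do 2 (rewrite ler_pM2l //).
  by rewrite /al; case: allis; case: allis => /=; lra.
pose S j w := \sum_(i <- iota 0 j) chi i w.
have cS j : cyl (S j) by apply: (mean_sum _ _).1.
have S2 j : mean (fun w => S j w * S j w) <= j%:R * (2 * 2 ^+ s).
  elim: j => [|j IH].
    rewrite mul0r -(mean_cst U 0) le_eqVlt; apply/orP; left; apply/eqP; congr mean.
    by apply/funext => w; rewrite /S big_nil mulr0.
  have SE w : S j.+1 w = S j w + chi j w.
    by rewrite /S -addn1 iotaD big_cat /= big_seq1.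
  have cSc : cyl (fun w => S j w * chi j w) by exact: (cyl_comp2 (fun x y : R => x * y)).
  have X : mean (fun w => S j w * chi j w) = 0.
    have -> : (fun w => S j w * chi j w) =
        (fun w => \sum_(i <- iota 0 j) (fun i w => chi i w * chi j w) i w).
      by apply/funext => w; rewrite /S mulr_suml.
    rewrite (mean_sum _ _).2; last by move=> i; exact: (cyl_comp2 (fun x y : R => x * y)).
    rewrite big_seq big1 // => i; rewrite mem_iota => /andP[_ ij].
    by apply: orth; rewrite neq_ltn ij.
  have -> : (fun w => S j.+1 w * S j.+1 w) =
      (fun w => (S j w * S j w + 2 * (S j w * chi j w)) + chi j w * chi j w).
    by apply/funext => w; rewrite SE; ring.
  have c1 : cyl (fun w => S j w * S j w) by exact: (cyl_comp2 (fun x y : R => x * y)).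
  have c2 : cyl (fun w => 2 * (S j w * chi j w)) by exact: (cyl_comp (fun x : R => 2 * x)).
  have c3 : cyl (fun w => chi j w * chi j w) by exact: (cyl_comp2 (fun x y : R => x * y)).
  rewrite meanD //; last exact: (cyl_comp2 (fun x y : R => x + y)).
  rewrite meanD // meanZ // X mulr0 addr0 -natr1 mulrDl mul1r; exact: lerD.
have cI := ind_cyl R cA.
have L1 : K%:R * (1 / 2) <= mean (fun w => S K w * ind A w).
  have -> : (fun w => S K w * ind A w) =
      (fun w => \sum_(i <- iota 0 K) (fun i w => chi i w * ind A w) i w).
    by apply/funext => w; rewrite /S mulr_suml.
  rewrite (mean_sum _ _).2; last by move=> i; exact: (cyl_comp2 (fun x y : R => x * y)).
  have -> : K%:R * (1 / 2) = \sum_(i <- iota 0 K) (1 / 2 : R).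
    by rewrite big_const_seq count_predT size_iota iter_addr_0 mulr_natl.
  rewrite big_seq [leRHS]big_seq; apply: ler_sum => i; rewrite mem_iota /= add0n => iK.
  by rewrite mchi //; apply: infl.
(* Weighted AM-GM in place of Cauchy-Schwarz. By orthogonality the quadratic term contributes at
   most K / 4, half of the lower bound K / 2, which leaves [K / 4 <= 2 * 2 ^+ s]. *)
have L2 : mean (fun w => S K w * ind A w) <=
    mean (fun w => (4 * 2 ^+ s)^-1 * (S K w * S K w) / 2 + 2 * 2 ^+ s).
  apply: le_mean.
  - exact: (cyl_comp2 (fun x y : R => x * y)).
  - exact: (cyl_comp (fun x : R => (4 * 2 ^+ s)^-1 * (x * x) / 2 + 2 * 2 ^+ s)).
  move=> w; set a := S K w; set p := 2 ^+ s; rewrite -/p in P0.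
  have a2 : a * ind A w <= `|a|.
    rewrite -[leRHS]mulr1; apply: le_trans (ler_norm _) _; rewrite normrM.
    by rewrite ler_wpM2l // ger0_norm ?ind_ge0 ?ind_le1.
  apply: le_trans a2 _.
  have -> : (4 * p)^-1 * (a * a) / 2 + 2 * p = (`|a| - 4 * p) ^+ 2 / (8 * p) + `|a|.
    have -> : a * a = `|a| * `|a| by rewrite -!expr2 real_normK ?num_real.
    by field; rewrite gt_eqF.
  by rewrite lerDr mulr_ge0 ?sqr_ge0 // invr_ge0 mulr_ge0 // ltW.
have E : mean (fun w => (4 * 2 ^+ s)^-1 * (S K w * S K w) / 2 + 2 * 2 ^+ s) =
    (4 * 2 ^+ s)^-1 / 2 * mean (fun w => S K w * S K w) + 2 * 2 ^+ s.
  have c1 : cyl (fun w => S K w * S K w) by exact: (cyl_comp2 (fun x y : R => x * y)).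
  rewrite -meanZ // -[X in _ + X](mean_cst U) -meanD; [|exact: (cyl_comp _ c1)|exact: cyl_cst].
  by congr mean; apply/funext => w; congr (_ + _); rewrite mulrAC.
have := S2 K; move: (le_trans L1 L2); rewrite E.
set M := mean _; set k := K%:R; set p := 2 ^+ s; rewrite -/p in P0.
move=> h1 h2.
have : (4 * p)^-1 / 2 * M <= (4 * p)^-1 / 2 * (k * (2 * p)).
  by rewrite ler_wpM2l // divr_ge0 // invr_ge0 mulr_ge0 // ltW.
have -> : (4 * p)^-1 / 2 * (k * (2 * p)) = k / 4 by field; rewrite gt_eqF.
move: h1; move: (_ / 2 * M) => q; clear; lra.
Qed.

End Influence.

(* The face with lower-left corner (x, y) is the dual site (x, y); [dual e] is
   the dual bond crossing [e]. *)
Definition dual (e : bond) : bond :=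
  if e.2 then ((e.1.1 - 1, e.1.2), false) else ((e.1.1, e.1.2 - 1), true).
Definition primal (e : bond) : bond :=
  if e.2 then ((e.1.1, e.1.2 + 1), false) else ((e.1.1 + 1, e.1.2), true).

Lemma dualK : cancel dual primal.
Proof. by move=> [[x y] []]; rewrite /dual /primal /=; congr (_, _, _); lia. Qed.
Lemma primalK : cancel primal dual.
Proof. by move=> [[x y] []]; rewrite /dual /primal /=; congr (_, _, _); lia. Qed.

(** For a vertical dual bond [e]: the sites to the right of the crossing, in the one row of sites
    that it crosses. *)
Definition shadow (e : bond) (p : site) : bool :=
  [&& e.2, p.2 == e.1.2 + 1 & e.1.1 < p.1].

(** Whether the horizontal ray going right from the face [q] crosses the primal bond [e]; these are
    the boundary terms at the two ends of a dual path. *)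
Definition left_of (e : bond) (q : site) : bool :=
  [&& e.2, q.2 == e.1.2 & q.1 < e.1.1].

(* The sites of a row to the right of a crossing carry a potential mod 2 whose
   jumps are the crossed bonds, except in the rows where the dual path ends. *)
Lemma shadow_bond (d e : bond) u v : joins d u v ->
  shadow d e.1 (+) shadow d (far_end e) =
  (e == primal d) (+) (left_of e u (+) left_of e v).
Proof.
have base : shadow d e.1 (+) shadow d (far_end e) =
    (e == primal d) (+) (left_of e d.1 (+) left_of e (far_end d)).
  case: d => [[a b] []]; case: e => [[x y] []];
    rewrite /shadow /left_of /primal /far_end /= !xpair_eqE ?andbF ?andbT //=;
    do ?[case: eqP => ? //=]; do ?[case: (ltrP _ _) => ? //=]; lia.
by case=> [[-> ->]|[-> ->]]; rewrite base //; congr (_ (+) _); rewrite addbC.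
Qed.

(** Sum of [shadow_bond] along the dual path. [k] is the parity of the vertical dual steps to the
    left of a site in its row, [N] the parity of the crossings of a bond, and the boundary terms
    telescope. The last clause locates the rows where [k] can be nonzero. *)
Lemma conn_shadow (S : bond -> Prop) (w : bond -> bool) u v : conn S w u v ->
  exists (k : site -> bool) (N : bond -> bool),
  [/\ forall e, k e.1 (+) k (far_end e) = N e (+) (left_of e u (+) left_of e v),
      forall e, N e -> S (dual e) /\ w (dual e) &
      forall p, k p -> exists2 d, S d & shadow d p].
Proof.
elim=> [|y d y' _ [k [N [kE NS kS]]] Sd wd j].
  by exists xpred0, xpred0; split => // e /=; rewrite addbb.
exists (fun p => k p (+) shadow d p), (fun e => N e (+) (e == primal d)); split.
- move=> e; rewrite addbACA kE (shadow_bond e j).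
  by move: (N e) (left_of e u) (left_of e y) (left_of e y') (e == _) => [] [] [] [] [].
- move=> e; case: eqP => [-> _|_]; first by rewrite primalK.
  by rewrite addbF; apply: NS.
- move=> p; case sp : (shadow d p); first by exists d.
  by rewrite addbF; apply: kS.
Qed.

(** Rows [- h] to [h + 1]: exactly the rows crossed by a dual path from face row [- h - 1] to face
    row [h + 1], faces being indexed by their lower-left corners. *)
Definition strip (a h : nat) (v : site) := rect a h.+1 v /\ - h%:Z <= v.2.

(** A parity argument in place of planar topology. The dual path, prolonged by [d1] above and [d2]
    below, cuts every row of the strip; the parity of the cuts to the left of a site is constant
    along open bonds, but it differs at [p] and [q]. *)
Lemma dual_separates (w : bond -> bool) (a' h : nat) (A : site -> Prop) (x1 x2 : int) (p q : site) :
  (forall v, A v -> - h%:Z <= v.2 <= h%:Z) ->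
  conn (inside A) (negb \o w \o primal) (x1, h%:Z) (x2, - h%:Z) ->
  0 <= x1 -> x2 < 0 ->
  ~~ w (primal ((x1, h%:Z), true)) -> ~~ w (primal ((x2, - h%:Z - 1), true)) ->
  p.2 = h%:Z + 1 -> p.1 <= 0 -> q.2 = - h%:Z -> 0 <= q.1 ->
  conn (inside (strip a' h)) w p q -> False.
Proof.
move=> Ah /conn_shadow[k [N [kE NS kS]]] x10 x20 w1 w2 p2 p1 q2 q1.
pose d1 : bond := ((x1, h%:Z), true); pose d2 : bond := ((x2, - h%:Z - 1), true).
(* In the rows [h + 1] and [- h] the potential [k] vanishes, and [d1], respectively [d2], supplies
   the only cut. *)
pose K (v : site) := k v (+) (shadow d1 v (+) shadow d2 v).
have k0 (v : site) : (v.2 = h%:Z + 1 \/ v.2 = - h%:Z) -> k v = false.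
  move=> vh; apply/negP => /kS [d [/Ah d1h /Ah d2h]].
  move: d1h d2h; rewrite /shadow /far_end; case: d.2 => //=; lia.
have Kp : K p = false.
  rewrite /K k0; last by left.
  have -> : shadow d1 p = false by rewrite /shadow /d1 /=; lia.
  by have -> : shadow d2 p = false by rewrite /shadow /d2 /=; lia.
have Kq : K q = true.
  rewrite /K k0; last by right.
  have -> : shadow d1 q = false by rewrite /shadow /d1 /=; lia.
  by have -> : shadow d2 q = true by rewrite /shadow /d2 /=; lia.
suff step e : inside (strip a' h) e -> w e -> K e.1 = K (far_end e).
  move=> pq; suff : K p = K q by rewrite Kp Kq.
  elim: pq => // v e v' _ -> ie we [[-> ->]|[-> ->]]; first exact: step.
  by rewrite step.
move=> [[_ lo] [hi _]] we.
have j1 : joins d1 (x1, h%:Z) (x1, h%:Z + 1) by left.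
have j2 : joins d2 (x2, - h%:Z - 1) (x2, - h%:Z) by left; rewrite /d2 /far_end /=; split => //; congr (_, _); lia.
have := shadow_bond e j1; have := shadow_bond e j2; have := kE e.
have -> : N e = false.
  by apply/negP => /NS[_]; rewrite /= dualK we.
have /negbTE -> : e != primal d1 by apply: contraNneq w1 => <-.
have /negbTE -> : e != primal d2 by apply: contraNneq w2 => <-.
(* The outer ends of [d1] and [d2] lie in face rows that no vertical bond of the strip meets; the
   boundary terms at the inner ends cancel those of the path. *)
have -> : left_of e (x1, h%:Z + 1) = false.
  by move: lo hi; rewrite /left_of /rect /far_end; case: e.2 => //=; lia.
have -> : left_of e (x2, - h%:Z - 1) = false.
  by move: lo hi; rewrite /left_of /rect /far_end; case: e.2 => //=; lia.
rewrite /K; move: (k e.1) (k (far_end e)) (shadow d1 e.1) (shadow d1 (far_end e)).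
move: (shadow d2 e.1) (shadow d2 (far_end e)) (left_of e (x1, h%:Z)) (left_of e (x2, - h%:Z)).
by move=> [] [] [] [] [] [] [] [].
Qed.

(** * Translated arms and crossings of a strip *)

Definition hshift (j : int) (e : bond) : bond := ((e.1.1 + j, e.1.2), e.2).

Lemma hshiftK j : cancel (hshift j) (hshift (- j)).
Proof. by move=> [[x y] b]; rewrite /hshift /=; congr (_, _, _); lia. Qed.
Lemma hshiftNK j : cancel (hshift (- j)) (hshift j).
Proof. by move=> [[x y] b]; rewrite /hshift /=; congr (_, _, _); lia. Qed.

Lemma joins_hshift j e u v : joins e u v ->
  joins (hshift j e) (u.1 + j, u.2) (v.1 + j, v.2).
Proof.
case: e => [[x y] []]; rewrite /hshift /joins /far_end /=;
  by case=> [[-> ->]|[-> ->]]; [left|right]; split => //=; congr (_, _); lia.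
Qed.

Definition srect (j : int) (a h : nat) (v : site) := rect a h (v.1 - j, v.2).

Lemma inside_hshift j a h e : inside (rect a h) e -> inside (srect j a h) (hshift j e).
Proof.
by case: e => [[x y] []]; rewrite /hshift /srect /inside /far_end /rect /= => -[[? ?] [? ?]];
  do !split; lia.
Qed.

Lemma up_arm_hshift j n a h (X : int -> Prop) w : up_arm n a h X (w \o hshift j) ->
  exists u x, [/\ srect j n n u, X (x - j) /\ - a%:Z <= x - j <= a%:Z,
    conn (inside (srect j a h)) w u (x, h%:Z) & w ((x, h%:Z), true)].
Proof.
move=> [u [x [nu [Xx xa] ux wx]]]; exists (u.1 + j, u.2), (x + j); split => //.
- by move: nu; rewrite /srect /rect /=; lia.
- by rewrite addrK.
- by have := conn_map (@joins_hshift j) (@inside_hshift j a h) ux.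
Qed.

Lemma down_arm_hshift j n a h (X : int -> Prop) w : up_arm n a h X (w \o hshift j \o flipy) ->
  exists u x, [/\ srect j n n u, X (x - j) /\ - a%:Z <= x - j <= a%:Z,
    conn (inside (srect j a h)) w u (x, - h%:Z) & w ((x, - h%:Z - 1), true)].
Proof.
move=> [u [x [nu [Xx xa] ux wx]]]; exists (u.1 + j, - u.2), (x + j); split => //.
- by move: nu; rewrite /srect /rect /=; lia.
- by rewrite addrK.
- have := conn_map joins_flipy (@inside_flipy a h) ux.
  by move/(conn_map (@joins_hshift j) (@inside_hshift j a h)).
Qed.

Definition square (x y : int) (m : nat) (v : site) :=
  (x <= v.1 < x + m%:Z) /\ (y <= v.2 < y + m%:Z).

Lemma square_conn x y m (w : bond -> bool) :
  (forall e, inside (square x y m) e -> w e) ->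
  forall u v, square x y m u -> square x y m v -> conn (inside (square x y m)) w u v.
Proof.
move=> wS; suff root v : square x y m v -> conn (inside (square x y m)) w (x, y) v.
  by move=> u v /root/conn_sym xu /root; apply: conn_trans xu.
have hor i : (i < m)%N -> conn (inside (square x y m)) w (x, y) (x + i%:Z, y).
  elim: i => [|i IH] im; first by rewrite addr0; apply: conn_refl.
  have ie : inside (square x y m) ((x + i%:Z, y), false).
    by rewrite /inside /far_end /square /=; do !split; lia.
  apply: (conn_step (IH (ltnW im)) ie (wS _ ie)); left; rewrite /far_end /=; split => //.
  by congr (_, _); lia.
have ver i k : (i < m)%N -> (k < m)%N ->
    conn (inside (square x y m)) w (x, y) (x + i%:Z, y + k%:Z).
  move=> im; elim: k => [|k IH] km; first by rewrite addr0; apply: hor.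
  have ie : inside (square x y m) ((x + i%:Z, y + k%:Z), true).
    by rewrite /inside /far_end /square /=; do !split; lia.
  apply: (conn_step (IH (ltnW km)) ie (wS _ ie)); left; rewrite /far_end /=; split => //.
  by congr (_, _); lia.
move=> [v1 v2]; have := ver `|(v.1 - x)%R|%N `|(v.2 - y)%R|%N.
have -> : (x + `|(v.1 - x)%R|%N, y + `|(v.2 - y)%R|%N) = v.
  by rewrite [RHS]surjective_pairing; congr (_, _); lia.
by apply; lia.
Qed.

(** From the left half of the top row to the right half of the bottom row: what an open arm to the
    upper left and one to the lower right produce once joined, and what dual arms to the upper right
    and lower left prevent once joined. *)
Definition crossing (J a h : nat) (w : bond -> bool) := exists p q : site,
  [/\ p.2 = h%:Z + 1 /\ p.1 <= 0, q.2 = - h%:Z /\ 0 <= q.1 &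
      conn (inside (strip (a + J) h)) w p q].

Lemma cyl_crossing J a h : cyl (crossing J a h).
Proof.
apply: (@cyl_inside _ _ (a + J) h.+1) => w w' ww'; apply/propext.
have sub e : inside (strip (a + J) h) e -> inside (rect (a + J) h.+1) e.
  by case=> [[? _] [? _]]; split.
have mono w1 w2 : (forall e, inside (rect (a + J) h.+1) e -> w1 e = w2 e) ->
    crossing J a h w1 -> crossing J a h w2.
  move=> w12 [p [q [pP qP pq]]]; exists p, q; split => //; move: pq.
  by apply: conn_sub => e i; rewrite w12 //; exact: sub.
by split; apply: mono => e /ww'.
Qed.

(** The side [2 * n + 2] exceeds the [2 * n + 1] sites of the box by one, because [primal] shifts a
    coordinate by 1: the pad contains the bonds of the box and those crossed by its dual bonds. *)
Definition pad (j n : nat) := block (j%:Z - n%:Z) (- n%:Z) (2 * n + 2) (2 * n + 2).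

Lemma le_setcfgT (B : seq bond) w : le_cfg w (setcfg B true w).
Proof. by move=> e we; rewrite /setcfg; case: ifP. Qed.

Lemma le_setcfgF (B : seq bond) w : le_cfg (setcfg B false w) w.
Proof. by move=> e; rewrite /setcfg; case: ifP. Qed.

Section Pad.
Variables (n a h J j : nat).
Hypotheses (na : (n <= a)%N) (nh : (n <= h)%N) (jJ : (j + n + 1 <= J)%N).

Lemma crossing_open (w : bond -> bool) :
  up_arm n a h (fun x => x < - J%:Z) (w \o hshift j) ->
  up_arm n a h (fun x => J%:Z < x) (w \o hshift j \o flipy) ->
  crossing J a h (setcfg (pad j n) true w).
Proof.
move=> /up_arm_hshift[u [x [nu [xJ xa] ux wx]]] /down_arm_hshift[v [y [nv [yJ ya] vy _]]].
set w' := setcfg _ _ _; have ww' : le_cfg w w' by exact: le_setcfgT.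
exists (x, h%:Z + 1), (y, - h%:Z); split; first by split => //=; lia.
  by split => //=; lia.
have strp e : inside (srect j a h) e -> inside (strip (a + J) h) e.
  by case=> -[/= ? ?] [/= ? ?]; rewrite /strip /rect; do !split => /=; lia.
have ux' : conn (inside (strip (a + J) h)) w' u (x, h%:Z).
  by move: ux; apply: conn_sub => e /strp ? /ww'.
have vy' : conn (inside (strip (a + J) h)) w' v (y, - h%:Z).
  by move: vy; apply: conn_sub => e /strp ? /ww'.
have uv' : conn (inside (strip (a + J) h)) w' u v.
  have sq : conn (inside (square (j%:Z - n%:Z) (- n%:Z) (2 * n + 1))) w' u v.
    apply: square_conn.
    - move=> e [[? ?] _]; rewrite /w' /setcfg ifT // mem_block; lia.
    - by move: nu; rewrite /srect /rect /square /=; lia.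
    - by move: nv; rewrite /srect /rect /square /=; lia.
  move: sq; apply: conn_sub => e [[? ?] [? ?]] ->; split => //.
  by rewrite /strip /rect; do !split; lia.
apply: conn_trans vy'; apply: conn_trans uv'; apply: conn_sym.
apply: conn_step ux' _ (ww' _ wx) _; last by left.
by rewrite /inside /strip /rect /far_end /=; do !split; lia.
Qed.

Lemma crossing_closed (w : bond -> bool) :
  up_arm n a h (fun x => J%:Z < x) (negb \o (w \o (primal \o hshift j))) ->
  up_arm n a h (fun x => x < - J%:Z) (negb \o (w \o (primal \o hshift j \o flipy))) ->
  ~ crossing J a h (setcfg (pad j n) false w).
Proof.
pose wd := negb \o w \o primal.
move=> /(@up_arm_hshift j n a h _ wd)[u [x [nu [xJ xa] ux wx]]].
move=> /(@down_arm_hshift j n a h _ wd)[v [y [nv [yJ ya] vy wy]]].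
set w' := setcfg _ _ _; have ww' : le_cfg wd (negb \o w' \o primal).
  by move=> e; rewrite /wd /=; apply: contra; exact: le_setcfgF.
move=> [p [q [[p2 p1] [q2 q1] pq]]].
have uv' : conn (inside (srect j a h)) (negb \o w' \o primal) u v.
  have sq : conn (inside (square (j%:Z - n%:Z) (- n%:Z) (2 * n + 1)))
      (negb \o w' \o primal) u v.
    apply: square_conn.
    - move=> e [[? ?] _]; rewrite /= /w' /setcfg ifT // mem_block /primal.
      by case: e.2 => /=; lia.
    - by move: nu; rewrite /srect /rect /square /=; lia.
    - by move: nv; rewrite /srect /rect /square /=; lia.
  move: sq; apply: conn_sub => e [[? ?] [? ?]] ->; split => //.
  by rewrite /srect /rect; do !split => /=; lia.
have xy : conn (inside (srect j a h)) (negb \o w' \o primal) (x, h%:Z) (y, - h%:Z).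
  apply: conn_trans (conn_le ww' vy); apply: conn_trans uv'.
  exact: conn_sym (conn_le ww' ux).
apply: (dual_separates _ xy _ _ _ _ p2 p1 q2 q1 pq); last exact: (ww' _ wy).
- by move=> z [_ /=].
- lia.
- lia.
- exact: (ww' _ wx).
Qed.

End Pad.

(** * Decay of the exit probability *)

Section OneArm.
Variable R : realType.

(* Otherwise each of K pads on the horizontal axis would be pivotal for
   [crossing] with probability at least 1/2: opening it joins its two open arms,
   closing it joins its two dual arms into a barrier. *)
Lemma box_escape n : exists2 N, (n <= N)%N & pr R (box_exits n N N) < 1 - (2 ^+ 14)^-1.
Proof.
apply: contrapT => no.
have hyp N : (n <= N)%N -> 1 - (2 ^+ 14)^-1 <= pr R (box_exits n N N).
  by move=> nN; rewrite leNgt; apply/negP => lt; apply: no; exists N.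
have [s sE] : exists s, s = ((2 * n + 2) * (2 * n + 2) * 2)%N by eexists.
(* [K] just exceeds the bound of [block_influence_bound] for blocks of size [s]. The pads are spaced
   by [2 * n + 3], more than their side, and [J] is at least [j i + n + 1] for all of them. *)
have [K KE] : exists K, K = (8 * 2 ^ s).+1 by eexists.
have [J JE] : exists J, J = (K * (2 * n + 3))%N by eexists.
have [a [h [na nh arm]]] := corner_arm_likely J hyp.
pose j i := (i * (2 * n + 3))%N.
have : K%:R <= 8 * 2 ^+ s :> R.
  apply: (block_influence_bound (B := fun i => pad (j i) n) (A := crossing J a h)).
  - by move=> i; apply: uniq_block.
  - by move=> i; rewrite size_block.
  - move=> i k e ik; rewrite !mem_block /j => h1; apply/negP => h2.
    by case: (ltngtP i k) ik => // ik _; nia.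
  - exact: cyl_crossing.
  move=> i iK; have jJ : (j i + n + 1 <= J)%N by rewrite JE /j; nia.
  pose TL := up_arm n a h (fun x => x < - J%:Z).
  pose TR := up_arm n a h (fun x => J%:Z < x).
  have cTL : cyl TL by exact: cyl_up_arm.
  have TRE : TR = fun w => TL (w \o flipx) by exact: up_arm_right.
  have [cTR pTR] := pr_map R flipxK flipxK cTL; rewrite -TRE in cTR pTR.
  have arm' (t t' : bond -> bond) (cT : cancel t t') (cT' : cancel t' t) :
      cyl (fun w => TL (w \o t)) /\ 7 / 8 <= pr R (fun w => TL (w \o t)).
    by have [? ->] := pr_map R cT cT' cTL.
  have armR (t t' : bond -> bond) (cT : cancel t t') (cT' : cancel t' t) :
      cyl (fun w => TR (w \o t)) /\ 7 / 8 <= pr R (fun w => TR (w \o t)).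
    by have [? ->] := pr_map R cT cT' cTR; rewrite pTR.
  pose t1 := hshift (j i); pose t1' := hshift (- (j i)%:Z).
  have c1 : cancel t1 t1' := @hshiftK _; have c1' : cancel t1' t1 := @hshiftNK _.
  have cf := can_comp c1 flipyK; have cf' := can_comp flipyK c1'.
  have cp := can_comp primalK c1; have cp' := can_comp c1' dualK.
  have cpf := can_comp cp flipyK; have cpf' := can_comp flipyK cp'.
  have [cA1 pA1] := arm' _ _ c1 c1'; have [cA2 pA2] := armR _ _ cf cf'.
  have [cA3 pA3] := armR _ _ cp cp'; have [cA4 pA4] := arm' _ _ cpf cpf'.
  have cX b := cyl_setcfg (pad (j i) n) b (cyl_crossing J a h).
  have open : 3 / 4 <= pr R (fun w => crossing J a h (setcfg (pad (j i) n) true w)).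
    apply: le_trans (le_pr R (cylI cA1 cA2) (cX true) _); last first.
      by move=> w []; exact: crossing_open.
    by apply: le_trans (prI_ge _ cA1 cA2); lra.
  (* Self-duality: reversing all coins turns open arms read through [primal] into dual arms of the
     same probability. *)
  have [cB3 qB3] := pr_neg R cA3; have [cB4 qB4] := pr_neg R cA4.
  have closed : 3 / 4 <= 1 - pr R (fun w => crossing J a h (setcfg (pad (j i) n) false w)).
    rewrite -prN; last exact: (cX false).
    apply: le_trans (le_pr R (cylI cB3 cB4) (cylN (cX false)) _); last first.
      by move=> w []; exact: crossing_closed.
    by apply: le_trans (prI_ge _ cB3 cB4); rewrite qB3 qB4; lra.
  move: open closed; move: (pr R _) (pr R _) => x y; clear; lra.
apply/negP; rewrite -ltNge KE -natrX -natrM ltr_nat; exact: ltnSn.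
Qed.

(* Conditionally on leaving a box, leaving a box scales larger still costs a
   fixed factor, because the two events use disjoint sets of bonds. *)
Lemma origin_exits_small (d : R) : 0 < d ->
  exists2 N, (0 < N)%N & pr R (box_exits 0 N N) <= d.
Proof.
pose q : R := 1 - (2 ^+ 14)^-1 => d0.
have i0 : 0 < (2 ^+ 14 : R)^-1 by rewrite invr_gt0 exprn_gt0.
have i1 : (2 ^+ 14 : R)^-1 <= 1 by rewrite invf_le1 ?exprn_gt0 // exprn_ege1 // ler1n.
have q0 : 0 <= q by rewrite subr_ge0.
have [k qk] : exists k, q ^+ k <= d by apply: geometric_small => //; rewrite q0 /= /q ltrBlDr ltrDl.
suff [N N0 le] : exists2 N, (0 < N)%N & pr R (box_exits 0 N N) <= q ^+ k.
  by exists N => //; apply: le_trans le qk.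
elim: k {qk} => [|k [N N0 IH]].
  by exists 1%N => //; rewrite expr0; apply/pr_le1/cyl_box_exits.
have [M NM lM] := box_escape N.+1.
exists M; first by apply: leq_trans NM.
pose B := block (- N.+1%:Z) (- N.+1%:Z) (2 * N.+1 + 1) (2 * N.+1 + 1).
pose Bi := [seq e <- B | `[< inside (rect N.+1 N.+1) e >]].
have memB e : (e \in Bi) = `[< inside (rect N.+1 N.+1) e >].
  rewrite mem_filter andb_idr // => /asboolP[[? ?] _]; rewrite mem_block; lia.
(* Forcing the inner bonds open makes the event independent of the inner box. It still implies an
   exit from the box of radius [N.+1] in [w]: keep the part of the path after its last inner
   bond. *)
pose ring w := box_exits N.+1 M M (setcfg Bi true w).
have cring : cyl ring by exact/cyl_setcfg/cyl_box_exits.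
have ringE w : ring w -> box_exits N.+1 M M w.
  move=> [u nu [v [e [v' [uv _ we j [rv nr]]]]]].
  have [u' nu' uv'] : exists2 u', rect N.+1 N.+1 u' & conn (inside (rect M M)) w u' v.
    elim: uv => [|x f x' _ [u' nu' ux'] fi wf jf]; first by exists u => //; exact: conn_refl.
    have [fB|fB] := boolP (f \in Bi).
      exists x'; last exact: conn_refl.
      by move: fB; rewrite memB => /asboolP fi'; have [] := inside_joins jf fi'.
    exists u' => //; apply: conn_step ux' fi _ jf.
    by move: wf; rewrite /setcfg (negPf fB).
  exists u' => //; exists v, e, v'; split => //.
  move: we; rewrite /setcfg memB; case: asboolP => // ie _; have [_ r'] := inside_joins j ie.
  by case: nr; move: r'; rewrite /rect; lia.
have sub w : box_exits 0 M M w -> box_exits 0 N N w /\ ring w.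
  move=> ex; split; first by apply: box_exits_antitone ex => //; exact: ltnW.
  move: ex => [u nu [v [e [v' [uv _ we j rr]]]]]; exists u; first by move: nu; rewrite /rect; lia.
  exists v, e, v'; split => //; last exact: le_setcfgT.
  exact: conn_le (@le_setcfgT _ _) uv.
apply: le_trans (_ : pr R (fun w => box_exits 0 N N w /\ ring w) <= _).
  by apply: le_pr sub; [exact: cyl_box_exits|apply: cylI => //; exact: cyl_box_exits].
have -> : pr R (fun w => box_exits 0 N N w /\ ring w) = pr R (box_exits 0 N N) * pr R ring.
  rewrite -(mean_indep (S := fun e => e \in Bi)); [|exact/ind_cyl/cyl_box_exits|exact: ind_cyl| |].
  - by congr mean; apply/funext => w; rewrite /ind asbool_and -natrM mulnb.
  - move=> w w' ww'; rewrite /ind (@box_exits_depends 0 N N w w') // => e ie.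
    by apply: ww'; rewrite memB; apply/asboolP.
  - move=> w w' ww'; rewrite /ind /ring; congr (nat_of_bool `[< box_exits _ _ _ _ >])%:R.
    by apply/funext => e; rewrite /setcfg; case: ifP => // /negbT /ww'.
rewrite exprSr; apply: ler_pM => //; try exact/pr_ge0/cyl_box_exits; first exact: pr_ge0.
apply: le_trans (ltW lM); apply: le_pr ringE => //; exact: cyl_box_exits.
Qed.

End OneArm.

(** * Comparison with percolation *)

(* The bound for a single edge, with A, B (resp. m, n) the signed (resp.
   total) weights of the two values of the edge variable: with
   q = (A n - B m)^2 / (m n), the left side is A^2/m + B^2/n minus
   eps (1 - eps) q (m + n) / (D0 D1), D0 + D1 = m + n, and
   4 eps (1 - eps) = 1 - (1 - 2 eps)^2 >= 1/2. *)
Lemma bsc_vs_erasure (R : realType) (eps A B m n : R) : 0 <= eps <= 1 ->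
  (1 - 2 * eps) ^+ 2 <= 2^-1 -> `|A| <= m -> `|B| <= n ->
  ((1 - eps) * A + eps * B) ^+ 2 / ((1 - eps) * m + eps * n) +
  (eps * A + (1 - eps) * B) ^+ 2 / (eps * m + (1 - eps) * n) <=
  ((A + B) ^+ 2 / (m + n) + (A ^+ 2 / m + B ^+ 2 / n)) / 2.
Proof.
move=> /andP[e0 e1] eps2 Am Bn.
have m0 : 0 <= m := le_trans (normr_ge0 _) Am.
have n0 : 0 <= n := le_trans (normr_ge0 _) Bn.
have sc c (x y : R) : (c * x) ^+ 2 / (c * y) = c * (x ^+ 2 / y).
  have [->|c0] := eqVneq c 0; first by rewrite !mul0r expr0n mul0r.
  by rewrite exprMn -mulf_div expr2 mulfK.
(* A zero total weight forces a zero signed weight, and its quotient is 0 by the convention on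
   division; both sides then coincide. *)
have [mz|mz] := eqVneq m 0.
  have : `|A| <= 0 by rewrite -[leRHS]mz.
  rewrite normr_le0 => /eqP A0; rewrite mz A0 !mulr0 !add0r expr0n mul0r add0r !sc.
  by move: (B ^+ 2 / n) => z; clear; nra.
have [nz|nz] := eqVneq n 0.
  have : `|B| <= 0 by rewrite -[leRHS]nz.
  rewrite normr_le0 => /eqP B0; rewrite nz B0 !mulr0 !addr0 expr0n mul0r addr0 !sc.
  by move: (A ^+ 2 / m) => z; clear; nra.
have {m0}m0 : 0 < m by rewrite lt_neqAle eq_sym mz.
have {n0}n0 : 0 < n by rewrite lt_neqAle eq_sym nz.
have D0 : 0 < (1 - eps) * m + eps * n by nra.
have D1 : 0 < eps * m + (1 - eps) * n by nra.
set d0 := _ + eps * n in D0 *; set d1 := eps * m + _ in D1 *.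
have id : (A ^+ 2 / m + B ^+ 2 / n) -
    (((1 - eps) * A + eps * B) ^+ 2 / d0 + (eps * A + (1 - eps) * B) ^+ 2 / d1) =
    (A * n - B * m) ^+ 2 / (m * n) * (eps * (1 - eps) * (m + n) / (d0 * d1)).
  by rewrite /d0 /d1; field; rewrite -/d0 -/d1 !gt_eqF.
have id2 : (A ^+ 2 / m + B ^+ 2 / n) - (A + B) ^+ 2 / (m + n) =
    (A * n - B * m) ^+ 2 / (m * n) * (m + n)^-1.
  by field; rewrite !gt_eqF // addr_gt0.
have q0 : 0 <= (A * n - B * m) ^+ 2 / (m * n).
  by rewrite divr_ge0 ?sqr_ge0 // mulr_ge0 // ltW.
(* Since [d0 * d1 <= (d0 + d1) ^+ 2 / 4], this reduces to [4 * (eps * (1 - eps)) >= 2^-1], the form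
   in which the threshold enters. *)
have key : (m + n)^-1 / 2 <= eps * (1 - eps) * (m + n) / (d0 * d1).
  rewrite ler_pdivlMr ?mulr_gt0 // mulrC mulrA ler_pdivrMr // ler_pdivrMr ?addr_gt0 //.
  have E : d0 + d1 = m + n by rewrite /d0 /d1; ring.
  have : 0 <= (d0 - d1) ^+ 2 by exact: sqr_ge0.
  have : 2^-1 <= 4 * (eps * (1 - eps)).
    by move: eps2; rewrite expr2 => ?; nra.
  rewrite -E; move: (eps * (1 - eps)) => p hp sq.
  have : d0 * d1 <= (d0 + d1) ^+ 2 / 4 by rewrite !expr2 in sq *; nra.
  have : 0 <= (d0 + d1) ^+ 2 by exact: sqr_ge0.
  by rewrite !expr2; nra.
have := ler_wpM2l q0 key.
rewrite -id mulrA -id2.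
move: (A ^+ 2 / m + B ^+ 2 / n) ((A + B) ^+ 2 / (m + n)) => x y.
by move: (_ / d0 + _ / d1) => z; clear; lra.
Qed.

(** * Squared correlations when channels are replaced by erasures *)

Section Comparison.
Variables (R : realType) (eps : R).
Hypotheses (eps01 : 0 <= eps <= 1) (eps2 : (1 - 2 * eps) ^+ 2 <= 2^-1).
Implicit Types (u : (site -> bool) -> R) (g : (site -> bool) -> bool).

Definition par (e : bond) (x : site -> bool) : bool := x e.1 (+) x (far_end e).

Definition chan (e : bond) b x : R := bsc eps (par e x) b.
Definition reveal (e : bond) b x : R := (par e x == b)%:R.

Definition amp g u : R := mean (fun x => (-1) ^+ g x * u x).
(** For an unnormalised posterior [u], the squared posterior mean of the sign times the probability
    of the observation, so that summing over observations gives an expectation. It is 0 when [u] has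
    total weight 0. *)
Definition corr2 g u : R := amp g u ^+ 2 / mean u.

(* Summing over the observations along the edges of [L] of the squared
   correlation, starting from the unnormalised posterior [u]. *)
Fixpoint info g (L : seq bond) u : R :=
  if L is e :: L' then
    info g L' (fun x => u x * chan e true x) + info g L' (fun x => u x * chan e false x)
  else corr2 g u.

Definition weight u := cyl u /\ forall x, 0 <= u x.

Lemma cyl_par e : cyl (par e).
Proof. by exists [:: e.1; far_end e] => x x' h; rewrite /par !h ?inE ?eqxx ?orbT. Qed.

Lemma weight_chan u e b : weight u -> weight (fun x => u x * chan e b x).
Proof.
move=> [cu u0]; split; first by apply: (cyl_comp2 (fun a p => a * bsc eps p b) cu (cyl_par e)).
by move=> x; rewrite mulr_ge0 // /chan /bsc; case/andP: eps01 => ? ?; case: ifP => _ //; lra.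
Qed.

Lemma weight_reveal u e b : weight u -> weight (fun x => u x * reveal e b x).
Proof.
move=> [cu u0]; split.
  by apply: (cyl_comp2 (fun a (p : bool) => a * (p == b)%:R) cu (cyl_par e)).
by move=> x; rewrite mulr_ge0 // /reveal ler0n.
Qed.

Lemma cyl_amp g u : cyl g -> cyl u -> cyl (fun x => (-1) ^+ g x * u x).
Proof. exact: (cyl_comp2 (fun (b : bool) (a : R) => (-1) ^+ b * a)). Qed.

Lemma mean_ge0 u : weight u -> 0 <= mean u.
Proof. by move=> [cu u0]; rewrite -(mean_cst site 0); apply: le_mean => //; exact: cyl_cst. Qed.

Lemma amp_le g u : cyl g -> weight u -> `|amp g u| <= mean u.
Proof.
move=> cg [cu u0]; rewrite ler_norml /amp -[- mean u]mulN1r -meanZ //; apply/andP; split; apply: le_mean;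
  rewrite ?cyl_amp //; try exact: cyl_amp; try exact: (cyl_comp (fun a : R => -1 * a)).
- by move=> x; have := u0 x; case: (g x); rewrite ?expr1 ?expr0; lra.
- by move=> x; have := u0 x; case: (g x); rewrite ?expr1 ?expr0; lra.
Qed.

Lemma chanE e b x : chan e b x = (1 - eps) * reveal e b x + eps * reveal e (~~ b) x.
Proof. by rewrite /chan /bsc /reveal; case: (par e x); case: b => /=; ring. Qed.

Lemma mean_split u e (c d : R) b : cyl u ->
  mean (fun x => u x * (c * reveal e b x + d * reveal e (~~ b) x)) =
  c * mean (fun x => u x * reveal e b x) + d * mean (fun x => u x * reveal e (~~ b) x).
Proof.
move=> cu; have cr b' : cyl (fun x => u x * reveal e b' x).
  by apply: (cyl_comp2 (fun a (p : bool) => a * (p == b')%:R) cu (cyl_par e)).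
rewrite -!meanZ // -meanD; [|exact: (cyl_comp (fun a : R => _ * a))..].
by congr mean; apply/funext => x; ring.
Qed.

Lemma amp_split g u e (c d : R) b : cyl g -> cyl u ->
  amp g (fun x => u x * (c * reveal e b x + d * reveal e (~~ b) x)) =
  c * amp g (fun x => u x * reveal e b x) + d * amp g (fun x => u x * reveal e (~~ b) x).
Proof.
move=> cg cu; have E F : amp g (fun x => u x * F x) = mean (fun x => (-1) ^+ g x * u x * F x).
  by congr mean; apply/funext => x; rewrite mulrA.
by rewrite !E mean_split //; exact: cyl_amp.
Qed.

(** [chan] mixes the two [reveal] posteriors with weights [1 - eps] and [eps], so [bsc_vs_erasure]
    applies to their signed and total weights. *)
Lemma corr2_step g u e : cyl g -> weight u ->
  corr2 g (fun x => u x * chan e true x) + corr2 g (fun x => u x * chan e false x) <=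
  (corr2 g u + (corr2 g (fun x => u x * reveal e true x) +
                corr2 g (fun x => u x * reveal e false x))) / 2.
Proof.
move=> cg wu; have cu := wu.1.
pose A := amp g (fun x => u x * reveal e true x).
pose B := amp g (fun x => u x * reveal e false x).
pose m := mean (fun x => u x * reveal e true x).
pose n := mean (fun x => u x * reveal e false x).
have Am : `|A| <= m by apply/amp_le/weight_reveal.
have Bn : `|B| <= n by apply/amp_le/weight_reveal.
have E b : (fun x => u x * chan e b x) =
    (fun x => u x * ((1 - eps) * reveal e b x + eps * reveal e (~~ b) x)).
  by apply/funext => x; rewrite chanE.
have E1 : u = fun x => u x * (1 * reveal e true x + 1 * reveal e false x).
  by apply/funext => x; rewrite /reveal; case: (par e x) => /=; ring.
have a0 : amp g u = A + B.
  by rewrite {1}E1 (amp_split e 1 1 true cg cu) !mul1r.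
have m0 : mean u = m + n.
  by rewrite {1}E1 (mean_split e 1 1 true cu) !mul1r.
have := bsc_vs_erasure eps01 eps2 Am Bn.
rewrite /corr2 !E !(amp_split e _ _ _ cg cu) !(mean_split e _ _ _ cu) /= a0 m0.
by rewrite -/A -/B -/m -/n [(1 - eps) * B + _]addrC [(1 - eps) * n + _]addrC.
Qed.

(** The updates by different edges commute, so the single-edge inequality can be summed over the
    observations along [L]. *)
Lemma info_step g L u e : cyl g -> weight u ->
  info g L (fun x => u x * chan e true x) + info g L (fun x => u x * chan e false x) <=
  (info g L u + (info g L (fun x => u x * reveal e true x) +
                 info g L (fun x => u x * reveal e false x))) / 2.
Proof.
move=> cg; elim: L u => [|e' L IH] u wu /=; first exact: corr2_step.
have C b f : (fun x => u x * f x * chan e' b x) = (fun x => u x * chan e' b x * f x).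
  by apply/funext => x; rewrite mulrAC.
rewrite !C; have := IH _ (weight_chan e' true wu); have := IH _ (weight_chan e' false wu).
by move: (info _ _ _) (info _ _ _) (info _ _ _) (info _ _ _) (info _ _ _) (info _ _ _)
  (info _ _ _) (info _ _ _) (info _ _ _) (info _ _ _) => *; lra.
Qed.

Definition same_spin (o v : site) (x : site -> bool) : bool := x o (+) x v.

Lemma cyl_same_spin o v : cyl (same_spin o v).
Proof. by exists [:: o; v] => x x' h; rewrite /same_spin !h ?inE ?eqxx ?orbT. Qed.

Definition linked (o v : site) (w : bond -> bool) : Prop := conn (fun=> True) w o v.

Definition depends_on_par (O : bond -> bool) u :=
  forall x x', (forall e, O e -> par e x = par e x') -> u x = u x'.

(* Without a path from o to v, flipping the cluster of o preserves all revealed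
   products and reverses the sign of the product of the two end spins. *)
Lemma corr2_le_linked o v (O : bond -> bool) u : weight u -> depends_on_par O u ->
  corr2 (same_spin o v) u <= mean u * ind (linked o v) O.
Proof.
move=> wu du; have [cu u0] := wu; rewrite /corr2.
have [ov|nov] := pselect (linked o v O).
  rewrite indT // mulr1; have := amp_le (cyl_same_spin o v) wu.
  have [->|mz] := eqVneq (mean u) 0; first by rewrite invr0 mulr0.
  have mu0 : 0 < mean u by rewrite lt_neqAle eq_sym mz mean_ge0.
  move=> h; rewrite ler_pdivrMr // -real_normK ?num_real // -expr2.
  by rewrite lerXn2r ?nnegrE // ltW.
rewrite indF // mulr0; set a := amp _ _; suff -> : a = 0 by rewrite expr0n mul0r.
suff : a = - 1 * a by lra.
pose c y := `[< conn (fun=> True) O o y >].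
have cf : cyl (fun x => (-1) ^+ same_spin o v x * u x : R).
  exact: cyl_amp (cyl_same_spin o v) cu.
rewrite /a /amp -meanZ // -(mean_flip c cf).2; congr mean; apply/funext => x.
have -> : u (fun y => c y (+) x y) = u x.
  apply: du => e Oe; rewrite /par.
  have -> : c (far_end e) = c e.1; last by case: (c e.1); case: (x e.1); case: (x _).
  have j : joins e e.1 (far_end e) by left.
  apply: asbool_equiv_eq; split => h; first exact: conn_step h I Oe (joins_sym j).
  exact: conn_step h I Oe j.
have co : c o by apply/asboolP; exact: conn_refl.
have cv : c v = false by apply/asboolP.
rewrite mulrA; congr (_ * _); rewrite /same_spin co cv.
by case: (x o); case: (x v) => /=; rewrite ?expr1 ?expr0; ring.
Qed.

(** [O] is the set of bonds revealed so far. The fair coin at [e] decides between erasing the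
    product, which keeps [u] and [O], and revealing it, which opens [e] and splits the weight of [u]
    in two. When [L] is exhausted, [O] is a percolation configuration. *)
Lemma info_le_linked o v L (O : bond -> bool) u : uniq L ->
  (forall e, e \in L -> O e = false) -> weight u -> depends_on_par O u ->
  info (same_spin o v) L u <= mean u * avg L (ind (linked o v)) O.
Proof.
elim: L O u => [|e L IH] O u /=; first by move=> _ _; exact: corr2_le_linked.
move=> /andP[eL uL] OL wu du; apply: le_trans (info_step L e (cyl_same_spin o v) wu) _.
have O0 : upd O e false = O.
  by apply/funext => f; rewrite /upd; case: eqP => // ->; rewrite OL // mem_head.
have OL' f : f \in L -> O f = false by move=> fL; apply: OL; rewrite inE fL orbT.
have OL1 f : f \in L -> upd O e true f = false.
  by move=> fL; rewrite /upd; case: eqP fL => [->|_ /OL' //]; rewrite (negPf eL).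
have du1 b : depends_on_par (upd O e true) (fun x => u x * reveal e b x).
  move=> x x' xx'; congr (_ * _).
    by apply: du => f Of; apply: xx'; rewrite /upd Of; case: ifP.
  by rewrite /reveal xx' // /upd eqxx.
have := IH O u uL OL' wu du.
have := IH _ _ uL OL1 (weight_reveal e true wu) (du1 true).
have := IH _ _ uL OL1 (weight_reveal e false wu) (du1 false).
have E : mean u = mean (fun x => u x * reveal e true x) + mean (fun x => u x * reveal e false x).
  have := mean_split e 1 1 true wu.1; rewrite !mul1r /= => <-.
  by congr mean; apply/funext => x; rewrite /reveal; case: (par e x) => /=; ring.
rewrite O0 E; move: (avg L _ _) (avg L _ _) (info _ _ _) (info _ _ _) (info _ _ _) => a1 a0.
by move: (mean _) (mean _) => m1 m0 i1 i2 i3; clear; nra.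
Qed.

Lemma linked_box_exits N v w : ~ rect N N v -> linked (0, 0) v w -> box_exits 0 N N w.
Proof.
move=> nv ov; exists (0, 0) => //; have [||//] := conn_exits (A := rect N N) _ ov.
- by rewrite /rect /=; lia.
- by case.
Qed.

Lemma weight1 : weight (fun=> 1).
Proof. by split => //; exact: cyl_cst. Qed.

Lemma info_small (d : R) : 0 < d -> exists N, forall v, ~ rect N N v ->
  forall L0 : seq bond, exists L, [/\ uniq L, {subset L0 <= L} &
    info (same_spin (0, 0) v) L (fun=> 1) <= d].
Proof.
move=> d0; have [N _ small] := origin_exits_small d0; exists N => v nv L0.
have [L1 L1d] := cyl_box_exits 0 N N.
(* [L] also covers the support [L1] of the exit event, so that averaging over [L] computes its full
   probability. *)
pose L := undup (L0 ++ L1); exists L; split; first exact: undup_uniq.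
  by move=> e eL; rewrite mem_undup mem_cat eL.
have uL : uniq L by exact: undup_uniq.
apply: le_trans (info_le_linked (O := fun=> false) _ _ _ _ weight1 _) _ => //.
rewrite mean_cst mul1r; apply: le_trans small.
rewrite /pr (meanE (fun=> false) uL); last first.
  move=> w w' ww'; rewrite /ind (L1d w w') // => e eL1; apply: ww'.
  by rewrite mem_undup mem_cat eL1 orbT.
apply: le_avg => w; have [lw|nl] := pselect (linked (0, 0) v w); last first.
  by rewrite (indF _ nl) ind_ge0.
by rewrite !indT //; apply: linked_box_exits lw.
Qed.

(** A global spin flip preserves all products along edges and reverses the sign. This yields the
    uniformity of each single spin given the observations. *)
Lemma info_odd g L u : cyl g -> (forall x, g (fun y => ~~ x y) = ~~ g x) ->
  cyl u -> (forall x, u (fun y => ~~ x y) = u x) -> info g L u = 0.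
Proof.
move=> cg go; elim: L u => [|e L IH] u cu eu /=; last first.
  have pe x : par e (fun y => ~~ x y) = par e x.
    by rewrite /par; case: (x _); case: (x _).
  have cc b : cyl (fun x => u x * chan e b x).
    by apply: (cyl_comp2 (fun a p => a * bsc eps p b) cu (cyl_par e)).
  by rewrite !IH ?addr0 // => x; rewrite eu /chan pe.
rewrite /corr2; set a := amp _ _; suff -> : a = 0 by rewrite expr0n mul0r.
suff : a = - 1 * a by lra.
have cf := cyl_amp cg cu.
rewrite /a /amp -meanZ // -(mean_flip (fun=> true) cf).2; congr mean; apply/funext => x.
have -> : u (fun y => true (+) x y) = u x by exact: eu.
have -> : g (fun y => true (+) x y) = ~~ g x by exact: go.
by case: (g x); rewrite ?expr1 ?expr0; ring.
Qed.

End Comparison.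

(** * Information in the observations *)

Section Probability.
Context d (Omega : measurableType d) (R : realType) (P : probability Omega R).
Implicit Types A B C : set Omega.

Definition mu A : R := fine (P A).

Lemma muE A : measurable A -> P A = (mu A)%:E.
Proof. by move=> mA; rewrite /mu fineK // fin_num_measure. Qed.

Lemma mu_ge0 A : 0 <= mu A.
Proof. by rewrite /mu fine_ge0. Qed.

Lemma mu_le A B : measurable A -> measurable B -> A `<=` B -> mu A <= mu B.
Proof.
by move=> mA mB AB; rewrite -lee_fin -!muE //; apply: le_measure => //; rewrite inE.
Qed.

Lemma mu_split A B : measurable A -> measurable B -> mu A = mu (A `&` B) + mu (A `&` ~` B).
Proof.
move=> mA mB; apply: EFin_inj; rewrite EFinD -!muE //; try exact: measurableI.
  by rewrite (measureDI P mA mB) setDE addeC.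
by apply: measurableI => //; exact: measurableC.
Qed.

Lemma mu_U A B : measurable A -> measurable B -> mu (A `|` B) <= mu A + mu B.
Proof.
move=> mA mB; rewrite -lee_fin EFinD -!muE //; last exact: measurableU.
exact: measureU2.
Qed.

Lemma mu_setT : mu setT = 1.
Proof. by rewrite /mu probability_setT. Qed.

Definition symd A B := (A `\` B) `|` (B `\` A).

Lemma measurable_symd A B : measurable A -> measurable B -> measurable (symd A B).
Proof. by move=> mA mB; apply: measurableU; apply: measurableD. Qed.

Lemma mu_symd A B C : measurable A -> measurable B -> measurable C ->
  `|mu (A `&` C) - mu (B `&` C)| <= mu (symd A B).
Proof.
move=> mA mB mC; have mS := measurable_symd mA mB.
have half A' B' : measurable A' -> measurable B' -> mu (A' `&` C) - mu (B' `&` C) <= mu (A' `\` B').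
  move=> mA' mB'; rewrite lerBlDl; apply: le_trans (mu_U _ _).
  - apply: mu_le; [exact: measurableI|apply: measurableU; [exact: measurableI|exact: measurableD]|].
    by move=> x [Ax Cx]; have [Bx|nB] := pselect (B' x); [left|right].
  - exact: measurableI.
  - exact: measurableD.
have sub1 : mu (A `\` B) <= mu (symd A B).
  by apply: mu_le => //; [exact: measurableD|left].
have sub2 : mu (B `\` A) <= mu (symd A B).
  by apply: mu_le => //; [exact: measurableD|right].
have h1 := le_trans (half _ _ mA mB) sub1; have h2 := le_trans (half _ _ mB mA) sub2.
by rewrite ler_norml; apply/andP; split; lra.
Qed.

(* The sets that are limits of an algebra [C] for the distance mu (A symd B)
   form a sigma-algebra. *)
Lemma sigma_approx (C G : set (set Omega)) :
  C `<=` measurable -> C set0 -> (forall A, C A -> C (~` A)) ->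
  (forall A B, C A -> C B -> C (A `|` B)) -> G `<=` C ->
  forall B, <<s G >> B -> measurable B /\
    forall z : R, 0 < z -> exists2 A, C A & mu (symd B A) <= z.
Proof.
move=> Cm C0 CC CU GC.
pose ap B := measurable B /\ forall z : R, 0 < z -> exists2 A, C A & mu (symd B A) <= z.
have apC B : C B -> ap B.
  move=> CB; split; first exact: Cm.
  by move=> z z0; exists B => //; rewrite /symd setDv setU0 /mu measure0 ltW.
have apU A B : ap A -> ap B -> ap (A `|` B).
  move=> [mA hA] [mB hB]; split; first exact: measurableU.
  move=> z z0; have z2 : 0 < z / 2 by rewrite divr_gt0.
  have [A' CA' lA] := hA _ z2; have [B' CB' lB] := hB _ z2.
  have mA' := Cm _ CA'; have mB' := Cm _ CB'.
  exists (A' `|` B'); first exact: CU.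
  apply: le_trans (_ : mu (symd A A') + mu (symd B B') <= _); last by lra.
  apply: le_trans (mu_U (measurable_symd _ _) (measurable_symd _ _)) => //.
  apply: mu_le.
  - by apply: measurable_symd; apply: measurableU.
  - by apply: measurableU; apply: measurable_symd.
  move=> x; rewrite /symd /=; tauto.
apply: smallest_sub; last by move=> B /GC /apC.
split; first exact: apC.
- move=> A [mA hA]; split; first exact: measurableD.
  move=> z z0; have [A' CA' l] := hA z z0; exists (~` A'); first exact: CC.
  have -> // : symd (setT `\` A) (~` A') = symd A A'.
  apply/seteqP; split => x; rewrite /symd /=; have [|] := pselect (A x); have [|] := pselect (A' x); tauto.
- move=> F hF; have mF n : measurable (F n) := (hF n).1.
  split; first exact: bigcup_measurable.
  move=> z z0; have z2 : 0 < z / 2 by rewrite divr_gt0.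
  (* By continuity from below, a finite partial union is within [z / 2] of the countable one, and
     finite unions are already approximable. *)
  pose S n := \big[setU/set0]_(i < n) F i.
  have apS n : ap (S n).
    elim: n => [|n IH]; first by rewrite /S big_ord0; exact: apC.
    by rewrite /S big_ord_recr /=; exact: apU.
  have mS n : measurable (S n) := (apS n).1.
  have SE : \bigcup_n S n = \bigcup_n F n.
    apply/seteqP; split => x [n _]; rewrite /S.
      by rewrite -bigcup_mkord => -[i _ Fx]; exists i.
    by move=> Fx; exists n.+1 => //; rewrite -bigcup_mkord; exists n => /=.
  have mU : measurable (\bigcup_n F n) by exact: bigcup_measurable.
  have cv : P \o S @ \oo --> P (\bigcup_n F n).
    rewrite -SE; apply: nondecreasing_cvg_mu => //; first by rewrite SE.
    by move=> i j ij; apply/subsetPset; rewrite /S -!bigcup_mkord; apply: bigcup_sub => k /= ki;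
      apply: bigcup_sup => /=; exact: leq_trans ij.
  have [n ln] : exists n, mu (\bigcup_n F n) - mu (S n) < z / 2.
    have cv' : mu (S n) @[n --> \oo] --> mu (\bigcup_n F n).
      by apply: fine_cvg; rewrite -muE.
    have /cvgrPdist_lt/(_ _ z2)[N _ /(_ N (leqnn N)) h] := cv'.
    by exists N; apply: le_lt_trans h; exact: ler_norm.
  have [A CA lA] := (apS n).2 _ z2; exists A => //; have mA := Cm _ CA.
  have E : mu (\bigcup_n F n) = mu (S n) + mu ((\bigcup_n F n) `\` S n).
    rewrite (mu_split mU (mS n)) setDE; congr (mu _ + _); apply/setIidr.
    by rewrite -SE; exact: bigcup_sup.
  apply: le_trans (_ : mu ((\bigcup_n F n) `\` S n) + mu (symd (S n) A) <= _); last by lra.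
  apply: le_trans (mu_U _ _); [|exact: measurableD|exact: measurable_symd].
  apply: mu_le; [exact: measurable_symd|apply: measurableU; [exact: measurableD|exact: measurable_symd]|].
  have sub : S n `<=` \bigcup_n F n by rewrite -SE; exact: bigcup_sup.
  move=> x; rewrite /symd /=; have [Sx|] := pselect (S n x).
    by have := sub _ Sx; tauto.
  by tauto.
Qed.

End Probability.

(** * Joint law of the spins and finitely many observations *)

Lemma bond_is_edge (e : bond) : is_edge (e.1, far_end e).
Proof.
by case: e => [[x y] []]; rewrite /is_edge /adj /l1dist /far_end /=; lia.
Qed.

Definition edge_of (e : bond) : edge := exist _ (e.1, far_end e) (bond_is_edge e).
Definition bond_of (f : edge) : bond := ((val f).1, (val f).1.1 == (val f).2.1).

Lemma edge_ofK : cancel edge_of bond_of.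
Proof.
move=> [[x y] b]; rewrite /bond_of /far_end /=; congr (_, _).
by case: b => /=; [rewrite eqxx|lia].
Qed.

Lemma bond_ofK : cancel bond_of edge_of.
Proof.
move=> [[[x y] [x' y']] f]; apply/val_inj; rewrite /= /bond_of /far_end /=.
move: (f); rewrite /is_edge /adj /l1dist /= => /and3P[/eqP ? ? ?].
by case: eqP => [xx|xx]; congr (_, (_, _)); lia.
Qed.

Lemma cyl_event (Omega : Type) (I : eqType) (Z : I -> Omega -> bool) (C : set (set Omega)) (g : (I -> bool) -> Prop) :
  C set0 -> (forall A, C A -> C (~` A)) ->
  (forall A B, C A -> C B -> C (A `|` B)) ->
  (forall i, C [set w | Z i w]) -> cyl g -> C [set w | g (fun i => Z i w)].
Proof.
move=> C0 CC CU CZ [L]; elim: L g => [|i L IH] g gL.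
  have gE w : g (fun i => Z i w) = g (fun=> true) by apply: gL.
  have [g0|ng] := pselect (g (fun=> true)).
    have -> : [set w | g (fun i => Z i w)] = ~` set0.
      by rewrite setC0; apply/seteqP; split => w /=; rewrite gE.
    exact: CC.
  have -> // : [set w | g (fun i => Z i w)] = set0.
  by apply/seteqP; split => w /=; rewrite gE.
have CI A B : C A -> C B -> C (A `&` B).
  by move=> CA CB; rewrite -[A `&` B]setCK setCI; apply/CC/CU; apply: CC.
have part b : C [set w | g (upd (fun i => Z i w) i b)].
  apply: (IH (fun x => g (upd x i b))) => x x' xx'; apply: gL => k; rewrite inE /upd.
  by case: eqP => //= _ /xx'.
have -> : [set w | g (fun i => Z i w)] =
    ([set w | Z i w] `&` [set w | g (upd (fun i => Z i w) i true)]) `|`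
    (~` [set w | Z i w] `&` [set w | g (upd (fun i => Z i w) i false)]).
  have E w : upd (fun i => Z i w) i (Z i w) = (fun i => Z i w).
    by apply/funext => k; rewrite /upd; case: eqP => // ->.
  apply/seteqP; split => w /=; have := E w; case: (Z i w) => ->.
  - by left.
  - by right.
  - by case=> [[]|[]].
  - by case=> [[]|[]].
by apply: CU; apply: CI => //; exact: CC.
Qed.

Section Instance.
Context d (Omega : measurableType d) (R : realType) (P : probability Omega R).
Variables (eps : R) (X : vertex -> {RV P >-> bool}) (Y : edge -> {RV P >-> bool}).
Hypothesis XY : sync_instance eps X Y.
Hypothesis eps01 : 0 <= eps <= 1.

Notation mu := (mu P).

Definition spins (w : Omega) : site -> bool := fun v => X v w.
Definition obs (w : Omega) : bond -> bool := fun e => Y (edge_of e) w.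

Lemma measurable_cyl (I : eqType) (Z : I -> {RV P >-> bool}) (g : (I -> bool) -> Prop) :
  cyl g -> measurable [set w | g (fun i => Z i w)].
Proof.
apply: cyl_event.
- exact: measurable0.
- by move=> A; exact: measurableC.
- by move=> A B; exact: measurableU.
- by move=> i; apply: (measurable_funPTI (Z i) (Y := [set true])).
Qed.

Definition spin_atom (V : seq site) (x : site -> bool) : set Omega :=
  [set w | forall i, i \in V -> X i w = x i].
Definition obs_atom (L : seq bond) (y : bond -> bool) : set Omega :=
  [set w | forall e, e \in L -> Y (edge_of e) w = y e].

Lemma spin_atomE V x : spin_atom V x =
  \bigcap_(i in [set` [fset i in V]%fset]) (X i @^-1` [set x i]).
Proof.
apply/seteqP; split => w /= h i.
  by rewrite /= inE /= => iV; apply: h.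
by move=> iV; apply: h; rewrite /= inE.
Qed.

Lemma obs_atomE L y : obs_atom L y =
  \bigcap_(f in [set` [fset f in map edge_of L]%fset]) (Y f @^-1` [set y (bond_of f)]).
Proof.
apply/seteqP; split => w /= h e.
  by rewrite /= inE /= => /mapP[e' eL ->]; rewrite edge_ofK; apply: h.
by move=> eL; rewrite (h (edge_of e)) ?edge_ofK //= inE map_f.
Qed.

Lemma perm_fset (T : choiceType) (s : seq T) : uniq s -> perm_eq [fset i in s]%fset s.
Proof. by move=> us; apply: uniq_perm => // i; rewrite inE. Qed.

Lemma cyl_spin_atom (V : seq site) (x : site -> bool) : cyl (fun z : site -> bool => forall i, i \in V -> z i = x i).
Proof.
exists V => z z' zz'; apply/propext; split => h i iV; first by rewrite -zz' // h.
by rewrite zz' // h.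
Qed.

Lemma measurable_spin_atom V x : measurable (spin_atom V x).
Proof. exact: (measurable_cyl X (cyl_spin_atom V x)). Qed.

Lemma measurable_obs_atom L y : measurable (obs_atom L y).
Proof.
rewrite obs_atomE; apply: fin_bigcap_measurable; first exact: finite_fset.
by move=> f _; exact: measurable_funPTI.
Qed.

Lemma mu_spin_atom V x : uniq V -> mu (spin_atom V x) = (2 ^+ size V)^-1.
Proof.
move=> uV; have indep := @spin_indep _ _ _ _ _ _ _ XY [fset i in V]%fset (fun i => [set x i]).
rewrite /mu spin_atomE indep //.
rewrite (perm_big _ (perm_fset uV)) /=.
rewrite (eq_bigr (fun=> (2^-1)%:E)); last by move=> i _; exact: (spin_uniform XY).
rewrite prodEFin /= big_const_seq count_predT iter_mulr_1 -exprVn //.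
Qed.

Lemma spin_atom_sigma V x : sigma_gen (fun v => X v : Omega -> bool) (spin_atom V x).
Proof.
apply: (cyl_event (Z := fun v => X v : Omega -> bool) _ _ _ _ (cyl_spin_atom V x)).
- exact: sigma_algebra0.
- by move=> A; exact: sigma_algebraC.
- move=> A B GA GB; rewrite -bigcup2E; apply: sigma_algebra_bigcup => -[|[|n]] //=.
  exact: sigma_algebra0.
- move=> i; apply: sub_sigma_algebra; exists i => //=; exists [set true] => //.
  by rewrite setTI.
Qed.

Definition likelihood (L : seq bond) (y : bond -> bool) (x : site -> bool) : R :=
  \prod_(e <- L) chan eps e (y e) x.

(** All endpoints of [L] have their spins fixed on [spin_atom V x], so the conditional probability
    given the spins is the constant [likelihood L y x] there. *)
Lemma mu_atoms L V x y : uniq L -> uniq V ->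
  (forall e, e \in L -> e.1 \in V /\ far_end e \in V) ->
  mu (obs_atom L y `&` spin_atom V x) = likelihood L y x / 2 ^+ size V.
Proof.
move=> uL uV LV.
have [_ _ /(_ _ (spin_atom_sigma V x))] :=
  obs_cond_law XY [fset f in map edge_of L]%fset (y \o bond_of).
rewrite -obs_atomE => E; rewrite /mu -E.
rewrite (eq_integral (fun=> (likelihood L y x)%:E)).
  rewrite integral_cst; last exact: measurable_spin_atom.
  rewrite [X in (_ * X)%E](_ : _ = ((2 ^+ size V)^-1)%:E) //.
  by rewrite -(mu_spin_atom x uV); exact/muE/measurable_spin_atom.
move=> w; rewrite inE => wV; congr (_%:E).
rewrite (perm_big _ (perm_fset _)) /=; last by rewrite map_inj_uniq //; exact: can_inj edge_ofK.
rewrite big_map; apply: eq_big_seq => e eL; have [e1 e2] := LV e eL.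
by rewrite /chan /par /src /tgt /= edge_ofK !wV.
Qed.

Lemma cyl_likelihood L y : cyl (likelihood L y).
Proof.
elim: L => [|e L IH].
  by exists [::] => x x' _; rewrite /likelihood !big_nil.
have -> : likelihood (e :: L) y = fun x => chan eps e (y e) x * likelihood L y x.
  by apply/funext => x; rewrite /likelihood big_cons.
exact: (cyl_comp2 (fun p a => bsc eps p (y e) * a) (cyl_par e) IH).
Qed.

Definition spin_event (g : (site -> bool) -> bool) : set Omega := [set w | g (spins w)].

Lemma measurable_spin_event g : cyl g -> measurable (spin_event g).
Proof. by move=> cg; apply: (measurable_cyl X (cyl_comp is_true cg)). Qed.

Lemma mu_obs_event L y (g : (site -> bool) -> bool) : uniq L -> cyl g ->
  mu (obs_atom L y `&` spin_event g) = mean (fun x => (g x)%:R * likelihood L y x).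
Proof.
move=> uL cg; have [Lg gd] := cg.
pose V0 := undup (Lg ++ flatten [seq [:: e.1; far_end e] | e <- L]).
have gV : depends g (fun i => i \in V0).
  by apply: depends_sub gd => i iL; rewrite mem_undup mem_cat iL.
have LV e : e \in L -> e.1 \in V0 /\ far_end e \in V0.
  move=> eL; rewrite !mem_undup !mem_cat; split; apply/orP; right; apply/flattenP;
  by exists [:: e.1; far_end e]; rewrite ?map_f ?inE ?eqxx ?orbT.
pose F x : R := (g x)%:R * likelihood L y x.
have FV : depends F (fun i => i \in V0).
  move=> x x' xx'; rewrite /F (gV x x') //; congr (_ * _).
  apply: eq_big_seq => e /LV[e1 e2]; by rewrite /chan /par !xx'.
have mG := measurable_spin_event cg; have mO := measurable_obs_atom L y.
(* Fix the spins of [W] one at a time: splitting the event by a spin matches the two branches of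
   [avg]. *)
have rec (W V : seq site) x : uniq (V ++ W) -> {subset V0 <= V ++ W} ->
    mu (obs_atom L y `&` spin_event g `&` spin_atom V x) = avg W F x / 2 ^+ size V.
  elim: W V x => [|i W IH] V x.
    rewrite cats0 => uV sV /=.
    have gx w : spin_atom V x w -> g (spins w) = g x.
      by move=> wV; apply: gV => j /sV /wV.
    rewrite /F; case gx' : (g x).
      have -> : obs_atom L y `&` spin_event g `&` spin_atom V x = obs_atom L y `&` spin_atom V x.
        apply/seteqP; split => w; first by case=> [[? _] ?].
        by move=> [? wV]; do !split => //; rewrite /spin_event /= gx.
      by rewrite mul1r mu_atoms // => e /LV[/sV ? /sV].
    have -> : obs_atom L y `&` spin_event g `&` spin_atom V x = set0.
      apply/seteqP; split => w //; case=> [[_ /= gw] wV]; move: gw.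
      by rewrite /spin_event /= gx // gx'.
    by rewrite /mu measure0 !mul0r.
  move=> uVW sV; have pVW : perm_eq (V ++ i :: W) ((i :: V) ++ W) by rewrite perm_catC /= perm_cons perm_catC.
  have iV : i \notin V by move: uVW; rewrite (perm_uniq pVW) /= mem_cat negb_or => /andP[/andP[]].
  have mS := measurable_spin_atom V x.
  rewrite (mu_split P (B := [set w | X i w])); last 2 first.
  - by apply: measurableI => //; exact: measurableI.
  - exact: (measurable_funPTI (X i) (Y := [set true])).
  have uVW' : uniq ((i :: V) ++ W) by rewrite -(perm_uniq pVW).
  have sV' : {subset V0 <= (i :: V) ++ W} by move=> j /sV; rewrite (perm_mem pVW).
  have E (b : bool) (B : set Omega) : (forall w, B w <-> X i w = b) ->
      mu (obs_atom L y `&` spin_event g `&` spin_atom V x `&` B) =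
      avg W F (upd x i b) / 2 ^+ (size V).+1.
    move=> BE; rewrite -(IH (i :: V) (upd x i b) uVW' sV'); congr (mu _).
    apply/seteqP; split => w.
      move=> [[LG wV] /BE Xi]; split=> // j; rewrite inE /upd.
      by case: eqP => [-> //|_ /= /wV].
    move=> [LG wV]; split; first split => // j jV.
      have := wV j; rewrite inE jV orbT /upd => ->//.
      by case: eqP => // ji; move: iV; rewrite -ji jV.
    by apply/BE; rewrite wV ?mem_head // /upd eqxx.
  rewrite (E true) // (E false); last by move=> w /=; case: (X i w); split.
  by rewrite exprS /=; field; rewrite expf_neq0 //=.
rewrite -/F (meanE (fun=> false) (undup_uniq _) FV).
have := rec V0 [::] (fun=> false) (undup_uniq _) (fun i h => h).
rewrite expr0 divr1 => <-; congr (mu _).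
by apply/seteqP; split => w; [move=> ?; split|case].
Qed.

Lemma mu_obs_atom L y : uniq L -> mu (obs_atom L y) = mean (likelihood L y).
Proof.
move=> uL; have := mu_obs_event y uL (cyl_cst site true).
have -> : obs_atom L y `&` spin_event (fun=> true) = obs_atom L y.
  by apply/seteqP; split => w //; case.
by move=> ->; congr mean; apply/funext => x; rewrite mul1r.
Qed.

(** The integral of the sign [(-1) ^+ g] over [A]. *)
Definition signed (g : (site -> bool) -> bool) (A : set Omega) : R :=
  mu (A `&` ~` spin_event g) - mu (A `&` spin_event g).

Lemma signed_obs_atom L y g : uniq L -> cyl g ->
  signed g (obs_atom L y) = amp g (likelihood L y).
Proof.
move=> uL cg; have mG := measurable_spin_event cg; have mO := measurable_obs_atom L y.
have cI : cyl (fun x => (g x)%:R * likelihood L y x).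
  exact: (cyl_comp2 (fun (b : bool) a => b%:R * a) cg (cyl_likelihood L y)).
have -> : signed g (obs_atom L y) =
    mu (obs_atom L y) - 2 * mu (obs_atom L y `&` spin_event g).
  by rewrite (mu_split P mO mG) /signed; lra.
rewrite mu_obs_atom // mu_obs_event // -meanZ // -meanB; [|exact: cyl_likelihood|].
  by congr mean; apply/funext => x; case: (g x); rewrite ?expr1 ?expr0 /=; ring.
exact: (cyl_comp (fun a : R => 2 * a)).
Qed.

Lemma signed_split g A B : cyl g -> measurable A -> measurable B ->
  signed g A = signed g (A `&` B) + signed g (A `&` ~` B).
Proof.
move=> cg mA mB; have mG := measurable_spin_event cg; have mG' := measurableC mG.
rewrite /signed (mu_split P (measurableI _ _ mA mG) mB) (mu_split P (measurableI _ _ mA mG') mB).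
have E C D : A `&` C `&` D = A `&` D `&` C by rewrite -!setIA [C `&` D]setIC.
by rewrite !(E (spin_event g)) !(E (~` spin_event g)); lra.
Qed.

Lemma likelihood_weight L y : weight (likelihood L y).
Proof.
split; first exact: cyl_likelihood.
move=> x; apply: prodr_ge0 => e _; rewrite /chan /bsc.
by case/andP: eps01 => ? ?; case: ifP => _ //; lra.
Qed.

Lemma likelihood_cons L y e b : e \notin L ->
  likelihood (e :: L) (upd y e b) = fun x => likelihood L y x * chan eps e b x.
Proof.
move=> eL; apply/funext => x; rewrite /likelihood big_cons mulrC {2}/upd eqxx; congr (_ * _).
apply: eq_big_seq => f fL; rewrite /upd; case: eqP => // fe; by rewrite fe (negPf eL) in fL.
Qed.

(** Linearised Cauchy-Schwarz: for a fixed [t] the right side is additive over observations, and [t]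
    is optimised only after summation. *)
Lemma amgm_corr2 (a m t : R) : 0 < t -> `|a| <= m -> `|a| <= (t * (a ^+ 2 / m) + m / t) / 2.
Proof.
move=> t0 am; have m0 := le_trans (normr_ge0 _) am.
have [mz|mz] := eqVneq m 0.
  by move: am; rewrite mz => am; rewrite invr0 mulr0 mulr0 mul0r addr0 mul0r.
have {m0}m0 : 0 < m by rewrite lt_neqAle eq_sym mz.
have -> : a ^+ 2 = `|a| ^+ 2 by rewrite real_normK ?num_real.
rewrite -subr_ge0.
have -> : (t * (`|a| ^+ 2 / m) + m / t) / 2 - `|a| = (t * `|a| - m) ^+ 2 / (2 * t * m).
  by field; rewrite !gt_eqF.
by rewrite divr_ge0 ?sqr_ge0 // !mulr_ge0 // ltW.
Qed.

(** Split over the observation atoms on [L]; those outside [phi] contribute 0. By [amgm_corr2] the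
    squared correlations add up to [info] and the total weights to 1, whence [t^-1]. *)
Lemma signed_cylinder g (phi : (bond -> bool) -> Prop) L (t : R) : cyl g -> 0 < t ->
  uniq L -> depends phi (fun e => e \in L) ->
  `|signed g [set w | phi (obs w)]| <= (t * info eps g L (fun=> 1) + t^-1) / 2.
Proof.
move=> cg t0 uL dphi.
have mphi : measurable [set w | phi (obs w)].
  by apply: (measurable_cyl (fun e => Y (edge_of e))); exists L.
have rec (W O : seq bond) y : uniq (O ++ W) -> {subset L <= O ++ W} ->
    `|signed g (obs_atom O y `&` [set w | phi (obs w)])| <=
    (t * info eps g W (likelihood O y) + mean (likelihood O y) / t) / 2.
  elim: W O y => [|e W IH] O y.
    rewrite cats0 => uO sO /=; have am := amp_le cg (likelihood_weight O y).
    have py w : obs_atom O y w -> phi (obs w) = phi y.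
      by move=> wO; apply: dphi => e /sO /wO.
    have [phiy|nphi] := pselect (phi y).
      have -> : obs_atom O y `&` [set w | phi (obs w)] = obs_atom O y.
        by apply/seteqP; split => w; [case|move=> wO; split => //=; rewrite py].
      by rewrite signed_obs_atom //; exact: amgm_corr2.
    have -> : obs_atom O y `&` [set w | phi (obs w)] = set0.
      by apply/seteqP; split => w //; case=> wO /=; rewrite py.
    rewrite /signed !set0I subrr normr0; apply: le_trans (amgm_corr2 t0 am).
    exact: normr_ge0.
  move=> uOW sO; have pOW : perm_eq (O ++ e :: W) ((e :: O) ++ W) by rewrite perm_catC /= perm_cons perm_catC.
  have eO : e \notin O by move: uOW; rewrite (perm_uniq pOW) /= mem_cat negb_or => /andP[/andP[]].
  have uOW' : uniq ((e :: O) ++ W) by rewrite -(perm_uniq pOW).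
  have sO' : {subset L <= (e :: O) ++ W} by move=> j /sO; rewrite (perm_mem pOW).
  have mB : measurable [set w | Y (edge_of e) w].
    exact: (measurable_funPTI (Y (edge_of e)) (Y := [set true])).
  rewrite (signed_split cg (measurableI _ _ (measurable_obs_atom O y) mphi) mB).
  have E (b : bool) (B : set Omega) : (forall w, B w <-> Y (edge_of e) w = b) ->
      obs_atom O y `&` [set w | phi (obs w)] `&` B =
      obs_atom (e :: O) (upd y e b) `&` [set w | phi (obs w)].
    move=> BE; apply/seteqP; split => w.
      move=> [[wO pw] /BE Ye]; split => // j; rewrite inE /upd.
      by case: eqP => [-> //|_ /= /wO].
    move=> [wO pw]; split; first split => // j jO.
      have := wO j; rewrite inE jO orbT /upd => -> //.
      by case: eqP => // je; move: eO; rewrite -je jO.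
    by apply/BE; rewrite wO ?mem_head // /upd eqxx.
  rewrite (E true) // (E false); last by move=> w /=; case: (Y _ w); split.
  have := IH (e :: O) (upd y e true) uOW' sO'; have := IH (e :: O) (upd y e false) uOW' sO'.
  rewrite !likelihood_cons //= => h0 h1; apply: le_trans (ler_normD _ _) _.
  have : mean (likelihood O y) = mean (fun x => likelihood O y x * chan eps e true x) +
      mean (fun x => likelihood O y x * chan eps e false x).
    rewrite -meanD; [|exact: (weight_chan eps01 e _ (likelihood_weight O y)).1..].
    congr mean; apply/funext => x; rewrite /chan /bsc.
    by case: (par e x) => /=; ring.
  move: h0 h1 => + + ->; move: (mean _) (mean _) (info _ _ _ _) (info _ _ _ _) => m1 m0 i1 i0.
  by move: `|_| `|_| => a1 a0; rewrite mulrDl mulrDr; clear; lra.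
have := rec L [::] (fun=> false) uL (fun e h => h).
have -> : obs_atom [::] (fun=> false) `&` [set w | phi (obs w)] = [set w | phi (obs w)].
  by apply/seteqP; split => w; [case|move=> ?; split].
have -> : likelihood [::] (fun=> false) = fun=> 1.
  by apply/funext => x; rewrite /likelihood big_nil.
by rewrite mean_cst mul1r.
Qed.

End Instance.

(** * From finitely many observations to the sigma-algebra of [Y] *)

Section SigmaObs.
Context d (Omega : measurableType d) (R : realType) (P : probability Omega R).
Variables (eps : R) (X : vertex -> {RV P >-> bool}) (Y : edge -> {RV P >-> bool}).
Hypothesis XY : sync_instance eps X Y.
Hypothesis eps01 : 0 <= eps <= 1.

Notation mu := (mu P).
Notation sigY := (sigma_gen (fun e => Y e : Omega -> bool)).

Lemma sigma_obs_approx B : sigY B -> measurable B /\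
  forall z : R, 0 < z -> exists2 phi : (bond -> bool) -> Prop, cyl phi &
    mu (symd B [set w | phi (obs Y w)]) <= z.
Proof.
pose C := [set A | exists2 phi : (bond -> bool) -> Prop, cyl phi & A = [set w | phi (obs Y w)]].
have Cm : C `<=` measurable.
  by move=> _ [phi cphi ->]; exact: (measurable_cyl (fun e => Y (edge_of e)) cphi).
have C0 : C set0 by exists (fun=> False); [exact: cyl_cst|].
have CC A : C A -> C (~` A).
  by move=> [phi cphi ->]; exists (fun y => ~ phi y); [exact: cyl_comp|].
have CU A A' : C A -> C A' -> C (A `|` A').
  move=> [phi cphi ->] [phi' cphi' ->]; exists (fun y => phi y \/ phi' y) => //.
  exact: cyl_comp2.
have GC : \bigcup_(i in [set: edge]) preimage_set_system [set: Omega] (Y i : Omega -> bool) measurable `<=` C.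
  move=> _ [i _ [S _ <-]]; exists (fun y => S (y (bond_of i))).
    by exists [:: bond_of i] => y y' yy'; rewrite yy' ?mem_head.
  by rewrite setTI; apply/seteqP; split => w; rewrite /obs /= bond_ofK.
move=> /(sigma_approx P Cm C0 CC CU GC)[mB aB]; split => // z /aB[_ [phi cphi ->] l].
by exists phi.
Qed.

Lemma signed_symd g A B : cyl g -> measurable A -> measurable B ->
  `|signed X g A| <= `|signed X g B| + 2 * mu (symd A B).
Proof.
move=> cg mA mB; have mG := measurable_spin_event X cg.
have h1 := mu_symd P mA mB mG; have h2 := mu_symd P mA mB (measurableC mG).
rewrite -lerBlDl; apply: le_trans (lerB_dist _ _) _; rewrite /signed.

have -> : forall a b c e : R, a - b - (c - e) = (a - c) - (b - e) by move=> *; ring.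
by apply: le_trans (ler_normB _ _) _; lra.
Qed.

(** The signed mass changes by at most twice the measure of the symmetric difference, so a bound on
    finitely determined events extends to their limits. *)
Lemma signed_sigma g (b : R) : cyl g ->
  (forall phi : (bond -> bool) -> Prop, cyl phi -> `|signed X g [set w | phi (obs Y w)]| <= b) ->
  forall B, sigY B -> `|signed X g B| <= b.
Proof.
move=> cg hb B /sigma_obs_approx[mB aB]; apply/ler_addgt0Pr => z z0.
have [|phi cphi l] := aB (z / 2); first by rewrite divr_gt0.
have mC : measurable [set w | phi (obs Y w)].
  exact: (measurable_cyl (fun e => Y (edge_of e)) cphi).
apply: le_trans (signed_symd cg mB mC) _; have := hb _ cphi; lra.
Qed.

Lemma signed_spin_sigma (u : site) B : sigY B -> signed X (fun x => x u) B = 0.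
Proof.
have cg : cyl (fun x : site -> bool => x u).
  by exists [:: u] => x x' h; rewrite h // mem_head.
move=> sB; apply/eqP; rewrite -normr_le0; apply/ler_addgt0Pr => z z0; rewrite add0r.
apply: signed_sigma sB => // phi [L dL].
have uL := undup_uniq L.
have dphi : depends phi (fun e => e \in undup L) by apply: depends_sub dL => e; rewrite mem_undup.
(* Here [info] is 0, so a large [t] makes the bound as small as desired. *)
apply: le_trans (signed_cylinder XY eps01 (t := z^-1) cg _ uL dphi) _.
  by rewrite invr_gt0.
rewrite (info_odd _ _ cg) //; last exact: cyl_cst.
by rewrite mulr0 add0r invrK; lra.
Qed.

Lemma small_correlation (b : R) : (1 - 2 * eps) ^+ 2 <= 2^-1 -> 0 < b ->
  exists N, forall v, ~ rect N N v -> forall B, sigY B ->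
    `|signed X (same_spin (0, 0) v) B| <= b.
Proof.
move=> eps2 b0; have [|N hN] := info_small eps01 eps2 (d := b ^+ 2).
  by rewrite exprn_gt0.
exists N => v nv; apply: signed_sigma; first exact: cyl_same_spin.
move=> phi [L0 d0]; have [L [uL sL il]] := hN v nv L0.
have dphi : depends phi (fun e => e \in L) by apply: depends_sub d0 => e /sL.
(* With [info] at most [b ^+ 2], this [t] makes each of the two terms at most [b]. *)
apply: le_trans (signed_cylinder XY eps01 (t := b^-1) (cyl_same_spin _ _) _ uL dphi) _.
  by rewrite invr_gt0.
rewrite invrK; have : b^-1 * info eps (same_spin (0, 0) v) L (fun=> 1) <= b^-1 * b ^+ 2.
  by rewrite ler_wpM2l // invr_ge0 ltW.
by rewrite expr2 mulKf ?gt_eqF //; lra.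
Qed.

End SigmaObs.

(** * Conditional probabilities and their distance from 1/2 *)

Lemma ereal_sub_eq (R : realType) (x : \bar R) (a b : R) :
  (a%:E = x + b%:E)%E -> x = (a - b)%:E.
Proof. by case: x => [r| |] //= [->]; rewrite addrK. Qed.

Section ConditionalProbability.
Context d (Omega : measurableType d) (R : realType) (P : probability Omega R).
Variables (G : set (set Omega)) (A : set Omega) (p : Omega -> R).
Hypothesis GM : G `<=` measurable.
Hypothesis mA : measurable A.
Hypothesis cp : is_cond_prob P G A (fun w => (p w)%:E).
Hypothesis p0 : forall w, 0 <= p w.

Notation mu := (mu P).

Lemma cond_prob_measurable : measurable_fun setT p.
Proof.
have [_ /measurable_int mp _] := cp.
by apply/measurable_EFinP.
Qed.

Lemma cond_prob_sigma (S : set R) : measurable S -> G (p @^-1` S).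
Proof.
move=> mS; have [hG _ _] := cp.
have := hG _ (measurable_image_EFin mS).
have -> // : (fun w => (p w)%:E) @^-1` (EFin @` S) = p @^-1` S.
apply/seteqP; split => w /=; last by move=> ?; exists (p w).
by case=> r Sr [<-].
Qed.

Lemma integral_cond_prob_pos B : G B -> (forall w, B w -> 2^-1 <= p w) ->
  (\int[P]_(w in B) (2 * p w - 1)%:E)%E = (2 * mu (A `&` B) - mu B)%:E.
Proof.
move=> GB pB; have mB := GM GB; have [_ _ /(_ B GB) iB] := cp.
have mp : measurable_fun B p := measurable_funS measurableT (@subsetT _ B) cond_prob_measurable.
have m2 : measurable_fun B (fun w => 2 * p w).
  by apply: measurable_funM.
have e1 : (\int[P]_(w in B) ((2 * p w - 1)%:E + 1%:E))%E =
    (\int[P]_(w in B) (2 * p w - 1)%:E + \int[P]_(w in B) 1%:E)%E.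
  apply: ge0_integralD => //.
  - by move=> w /pB h; rewrite lee_fin; lra.
  - by apply/measurable_EFinP; apply: measurable_funB.
have e2 : (\int[P]_(w in B) ((2 * p w - 1)%:E + 1%:E))%E = (2%:E * \int[P]_(w in B) (p w)%:E)%E.
  rewrite -ge0_integralZl_EFin //; last by apply/measurable_EFinP.
    by apply: eq_integral => w _; rewrite -EFinD subrK EFinM.
  by move=> w _; rewrite lee_fin.
rewrite integral_cst // mul1e in e1; move: e1; rewrite e2 iB => e.
apply: ereal_sub_eq; rewrite EFinM.
have <- : P B = (mu B)%:E := muE P mB.
by have <- : P (A `&` B) = (mu (A `&` B))%:E := muE P (measurableI _ _ mA mB).
Qed.

Lemma integral_cond_prob_neg B : G B -> (forall w, B w -> p w <= 2^-1) ->
  (\int[P]_(w in B) (1 - 2 * p w)%:E)%E = (mu B - 2 * mu (A `&` B))%:E.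
Proof.
move=> GB pB; have mB := GM GB; have [_ _ /(_ B GB) iB] := cp.
have mp : measurable_fun B p := measurable_funS measurableT (@subsetT _ B) cond_prob_measurable.
have m2 : measurable_fun B (fun w => 2 * p w).
  by apply: measurable_funM.
have e1 : (\int[P]_(w in B) ((1 - 2 * p w)%:E + (2 * p w)%:E))%E =
    (\int[P]_(w in B) (1 - 2 * p w)%:E + \int[P]_(w in B) (2 * p w)%:E)%E.
  apply: ge0_integralD => //.
  - by move=> w /pB h; rewrite lee_fin; lra.
  - by apply/measurable_EFinP; apply: measurable_funB.
  - by move=> w _; rewrite lee_fin mulr_ge0.
  - by apply/measurable_EFinP.
have e2 : (\int[P]_(w in B) (2 * p w)%:E)%E = (2%:E * \int[P]_(w in B) (p w)%:E)%E.
  rewrite -ge0_integralZl_EFin //; last by apply/measurable_EFinP.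
  by move=> w _; rewrite lee_fin.
have e3 : (\int[P]_(w in B) ((1 - 2 * p w)%:E + (2 * p w)%:E))%E = (\int[P]_(w in B) 1%:E)%E.
  by apply: eq_integral => w _; rewrite -EFinD subrK.
move: e1; rewrite e3 integral_cst // mul1e e2 iB => e.
apply: ereal_sub_eq; rewrite EFinM.
have <- : P B = (mu B)%:E := muE P mB.
by have <- : P (A `&` B) = (mu (A `&` B))%:E := muE P (measurableI _ _ mA mB).
Qed.
End ConditionalProbability.

Section AlmostSure.
Context d (Omega : measurableType d) (R : realType) (P : probability Omega R).

(** Raising [g] to +oo on the null set leaves its integral unchanged and makes the inequality hold
    everywhere; the integral of [f], a supremum over the simple functions below it, is then compared
    directly. Here [f] will be [chi2_mi (kappa w)]. *)
Lemma integral_le_off_null (f g : Omega -> \bar R) (N : set Omega) :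
  measurable N -> P N = 0%E -> measurable_fun setT g ->
  (forall w, (0 <= f w)%E) -> (forall w, (0 <= g w)%E) ->
  (forall w, ~ N w -> (f w <= g w)%E) ->
  (\int[P]_w f w <= \int[P]_w g w)%E.
Proof.
move=> mN PN mg f0 g0 fg.
pose h w := if w \in N then +oo%E else g w.
have h0 w : (0 <= h w)%E by rewrite /h; case: ifP.
have mh : measurable_fun setT h.
  apply: measurable_fun_ifT => //; apply: (measurable_fun_bool true).
  rewrite setTI; have -> // : (fun w => w \in N) @^-1` [set true] = N.
  by apply/seteqP; split => w; [exact: set_mem|exact: mem_set].
have -> : (\int[P]_w g w = \int[P]_w h w)%E.
  apply: ge0_ae_eq_integral => //; exists N; split => // w /= nw.
  by apply: contrapT => nN; apply: nw => _; rewrite /h memNset.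
rewrite !ge0_integralTE //; apply: le_ereal_sup => _ [s /= sf <-]; exists s => // w.
apply: le_trans (sf w) _; rewrite /h; case: ifPn => [_|wN]; first exact: leey.
by apply: fg => Nw; move/negP: wN; apply; exact: mem_set.
Qed.

Variables (G : set (set Omega)) (A : set Omega) (p : Omega -> R).
Hypothesis GM : G `<=` measurable.
Hypothesis mA : measurable A.
Hypothesis cp : is_cond_prob P G A (fun w => (p w)%:E).
Hypothesis p0 : forall w, 0 <= p w.

(** Test on the sets where [p] is above and below 1/2. Both lie in [G], and the positive functions
    [2 * p - 1] and [1 - 2 * p] have integral 0 over them, so they are null. *)
Lemma cond_prob_half : (forall B, G B -> 2 * mu P (A `&` B) = mu P B) ->
  exists N, [/\ measurable N, P N = 0%E & forall w, ~ N w -> p w = 2^-1].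
Proof.
move=> half; pose Bp := [set w | 2^-1 < p w]; pose Bn := [set w | p w < 2^-1].
have mp := cond_prob_measurable cp.
have GBp : G Bp.
  have -> : Bp = p @^-1` `]2^-1, +oo[ by apply/seteqP; split => w; rewrite /= in_itv /= andbT.
  exact: cond_prob_sigma cp _ (measurable_itv _).
have GBn : G Bn.
  have -> : Bn = p @^-1` `]-oo, 2^-1[ by apply/seteqP; split => w; rewrite /= in_itv /=.
  exact: cond_prob_sigma cp _ (measurable_itv _).
have mBp := GM GBp; have mBn := GM GBn.
have null (B : set Omega) (f : Omega -> R) : measurable B -> measurable_fun setT f ->
    (forall w, B w -> 0 < f w) -> (\int[P]_(w in B) (f w)%:E = 0)%E -> P B = 0%E.
  move=> mB mf fB iB.
  have mf' : measurable_fun B (fun w => (f w)%:E).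
    apply/measurable_EFinP; exact: measurable_funS mf.
  have : (\int[P]_(w in B) `|(f w)%:E| = 0)%E.
    by rewrite -[RHS]iB; apply: eq_integral => w; rewrite inE => /fB h; rewrite gee0_abs // lee_fin ltW.
  move/(ae_eq_integral_abs P mB mf') => [N [mN PN BN]].
  apply/eqP; rewrite -measure_le0 -PN; apply: le_measure; rewrite ?inE // => w Bw.
  apply: BN => /= fw; have := fB w Bw; have [-> //] : (f w)%:E = 0%:E := fw Bw.
  by rewrite ltxx.
have m2 : measurable_fun setT (fun w => 2 * p w) by exact: measurable_funM.
have Pp : P Bp = 0%E.
  apply: (null _ (fun w => 2 * p w - 1)) => //; first exact: measurable_funB.
    by move=> w; rewrite /Bp /=; lra.
  rewrite (integral_cond_prob_pos GM mA cp p0 GBp); last by move=> w /ltW.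
  by rewrite half // subrr.
have Pn : P Bn = 0%E.
  apply: (null _ (fun w => 1 - 2 * p w)) => //; first exact: measurable_funB.
    by move=> w; rewrite /Bn /=; lra.
  rewrite (integral_cond_prob_neg GM mA cp p0 GBn); last by move=> w /ltW.
  by rewrite half // subrr.
exists (Bp `|` Bn); split; first exact: measurableU.
- rewrite muE; last exact: measurableU.
  congr (_%:E); apply/eqP; rewrite eq_le mu_ge0 andbT.
  by apply: le_trans (mu_U P mBp mBn) _; rewrite /mu Pp Pn addr0.
- move=> w nN; apply/eqP; rewrite eq_le; apply/andP; split; rewrite leNgt; apply/negP => h;
    by apply: nN; first [by left|by right].
Qed.

(** [2 * p - 1] changes sign between two complementary sets of [G], so its L1 norm is determined by
    the masses of [A] on these two sets alone. *)
Lemma integral_cond_prob_dist :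
  (\int[P]_w `|2 * p w - 1|%:E = ((2 * mu P (A `&` [set w | (2^-1 <= p w)%R]) - mu P [set w | (2^-1 <= p w)%R]) +
   (mu P (~` [set w | (2^-1 <= p w)%R]) - 2 * mu P (A `&` ~` [set w | (2^-1 <= p w)%R])))%:E)%E.
Proof.
set B := [set w | 2^-1 <= p w]; have mp := cond_prob_measurable cp.
have GB : G B.
  have -> : B = p @^-1` `[2^-1, +oo[ by apply/seteqP; split => w; rewrite /= in_itv /= andbT.
  exact: cond_prob_sigma cp _ (measurable_itv _).
have BcE : ~` B = p @^-1` `]-oo, 2^-1[.
  apply/seteqP; split => w; rewrite /B /= in_itv /= ltNge; first by move/negP.
  by move=> /negP.
have GBc : G (~` B) by rewrite BcE; exact: cond_prob_sigma cp _ (measurable_itv _).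
have mB := GM GB; have mBc := GM GBc.
have mf : measurable_fun setT (fun w => `|2 * p w - 1|%:E).
  apply/measurable_EFinP; apply: measurableT_comp => //.
  by apply: measurable_funB => //; exact: measurable_funM.
have E : setT = B `|` ~` B by rewrite setUv.
rewrite {1}E (ge0_integral_setU P mB mBc); first last.
- by apply/disj_setPS; rewrite setICr.
- by [].
- by rewrite -E.
rewrite EFinD; congr (_ + _)%E.
  rewrite -(integral_cond_prob_pos GM mA cp p0 GB) //.
  by apply: eq_integral => w; rewrite inE /B /= => h; rewrite ger0_norm //; lra.
rewrite -(integral_cond_prob_neg GM mA cp p0 GBc); last first.
  by move=> w; rewrite /B /= => /negP; rewrite -ltNge => /ltW.
apply: eq_integral => w; rewrite inE /B /= => /negP; rewrite -ltNge => h.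
by rewrite ler0_norm ?opprB //; lra.
Qed.

End AlmostSure.

(** * The chi-square information of two bits *)

Section ChiSquare.
Variable R : realType.
Notation BB := (bool * bool)%type.

Lemma measurable_bool2 (S : set BB) : measurable S.
Proof.
have -> : S = \bigcup_(z in S) [set z].
  by apply/seteqP; split => z; [move=> Sz; exists z|case=> x Sx ->].
apply: fin_bigcup_measurable => [|[a b] _]; first exact: finite_finset.
have -> : [set (a, b)] = [set a] `*` [set b].
  by apply/seteqP; split => -[x y] /=; [case=> -> ->|case=> -> ->].
exact: measurableX.
Qed.

Definition bool2 : seq BB := [:: (true, true); (true, false); (false, true); (false, false)].

Lemma integral_bool2 (Q : probability BB R) (f : BB -> R) : (forall z, 0 <= f z) ->
  (\int[Q]_z (f z)%:E = (\sum_(z <- bool2) f z * mu Q [set z])%:E)%E.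
Proof.
move=> f0.
have mf (D : set BB) : measurable_fun D (fun z => (f z)%:E).
  by move=> _ S _; exact: measurable_bool2.
have E : setT = \big[setU/set0]_(z <- bool2) [set z].
  rewrite /bool2 !big_cons big_nil; apply/seteqP; split => -[[] []] //= _; tauto.
rewrite {1}E (@ge0_integral_bigsetU _ _ _ Q BB (fun z => [set z])) //.
- rewrite -sumEFin; apply: eq_bigr => z _.
  rewrite (eq_integral (fun=> (f z)%:E)); last by move=> x; rewrite inE => ->.
  rewrite integral_cst; last exact: measurable_bool2.
  by rewrite EFinM; congr (_ * _)%E; exact: (muE Q (measurable_bool2 [set z])).
- by move=> z; exact: measurable_bool2.
- by move=> z z' _ _ [x [-> ->]].
- by move=> z _; rewrite lee_fin.
Qed.

Lemma mu_bool2 (Q : probability BB R) (S : set BB) :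
  mu Q S = \sum_(z <- bool2) (`[< S z >])%:R * mu Q [set z].
Proof.
have mS := measurable_bool2 S.
have f0 (z : BB) : 0 <= \1_S z :> R by rewrite indicE ler0n.
have := integral_bool2 Q f0.
have -> : (\int[Q]_z (\1_S z)%:E)%E = (mu Q S)%:E.
  by rewrite integral_indic // setIT; exact: (muE Q mS).
move=> [->]; apply: eq_bigr => z _; rewrite indicE; congr (_ * _).
Qed.

(** With uniform marginals the law is determined by [a], and the chi-square sum collapses to the
    square of [2 * (a + e) - 1], whose absolute value is at most 1. *)
Lemma bool2_law_bound (a b c e : R) : 0 <= a -> 0 <= b -> 0 <= c -> 0 <= e ->
  a + (b + (c + e)) = 1 -> a + b = 2^-1 -> a + c = 2^-1 ->
  (4 * a - 1) ^+ 2 * 4^-1 + ((4 * b - 1) ^+ 2 * 4^-1 +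
  ((4 * c - 1) ^+ 2 * 4^-1 + (4 * e - 1) ^+ 2 * 4^-1)) <= `|2 * (a + e) - 1|.
Proof.
move=> a0 b0 c0 e0 s0 s1 s2.
have -> : b = 2^-1 - a by lra.
have -> : c = 2^-1 - a by lra.
have -> : e = a by lra.
set t := `|_|.
have t1 : t <= 1 by rewrite /t ler_norml; lra.
have E : t ^+ 2 = (4 * a - 1) ^+ 2 by rewrite /t real_normK ?num_real //; ring.
have -> : (4 * a - 1) ^+ 2 * 4^-1 + ((4 * (2^-1 - a) - 1) ^+ 2 * 4^-1 +
  ((4 * (2^-1 - a) - 1) ^+ 2 * 4^-1 + (4 * a - 1) ^+ 2 * 4^-1)) = (4 * a - 1) ^+ 2 by field.
by rewrite -E expr2 ler_piMr // normr_ge0.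
Qed.

Lemma chi2_mi_uniform (nu : probability BB R) :
  mu nu [set z : BB | z.1] = 2^-1 -> mu nu [set z : BB | z.2] = 2^-1 ->
  (chi2_mi nu <= `|2 * mu nu [set z : BB | ~~ (z.1 (+) z.2)] - 1|%:E)%E.
Proof.
move=> h1 h2; pose q z := mu nu [set z].
have sumE (f : BB -> bool) : mu nu [set z | f z] = \sum_(z <- bool2) (f z)%:R * q z.
  by rewrite mu_bool2; apply: eq_bigr => z _; rewrite asboolb.
have s0 : q (true, true) + (q (true, false) + (q (false, true) + q (false, false))) = 1.
  rewrite -(mu_setT nu) mu_bool2 /bool2 !big_cons big_nil addr0.
  by rewrite !asboolT // !mul1r.
have s1 : q (true, true) + q (true, false) = 2^-1.
  by rewrite -h1 sumE /bool2 !big_cons big_nil /= !mul1r !mul0r !addr0.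
have s2 : q (true, true) + q (false, true) = 2^-1.
  by rewrite -h2 sumE /bool2 !big_cons big_nil /= !mul1r !mul0r !addr0 add0r.
pose Q := marginal_product nu.
have marg1 a : distribution nu (@fst bool bool) [set a] = (2^-1)%:E.
  have -> : distribution nu (@fst bool bool) [set a] = (mu nu [set z : BB | z.1 == a])%:E.
    rewrite -(muE nu (measurable_bool2 _)); congr (nu _).
    by apply/seteqP; split => z /=; [move=> ->|move=> /eqP].
  rewrite sumE /bool2 !big_cons big_nil /=; congr (_%:E).
  by case: a => /=; rewrite !mul1r !mul0r; lra.
have marg2 a : distribution nu (@snd bool bool) [set a] = (2^-1)%:E.
  have -> : distribution nu (@snd bool bool) [set a] = (mu nu [set z : BB | z.2 == a])%:E.
    rewrite -(muE nu (measurable_bool2 _)); congr (nu _).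
    by apply/seteqP; split => z /=; [move=> ->|move=> /eqP].
  rewrite sumE /bool2 !big_cons big_nil /=; congr (_%:E).
  by case: a => /=; rewrite !mul1r !mul0r; lra.
have Qz z : Q [set z] = (4^-1)%:E.
  have -> : [set z] = [set z.1] `*` [set z.2].
    by apply/seteqP; split => -[x y] /=; [move=> <-|case: z => ? ? [/= -> ->]].
  have -> : (4^-1)%:E = ((2^-1)%:E * (2^-1)%:E)%E :> \bar R.
    by rewrite -EFinM; congr (_%:E); field.
  rewrite /Q /marginal_product /= product_measure1E //.
  by congr (_ * _)%E; [exact: marg1|exact: marg2].
have dom : nu `<< Q.
  move=> N /= QN A mA AN; have -> : A = set0; last exact: measure0.
  apply/seteqP; split => // z Az; have := QN [set z] (measurable_bool2 _).
  have zN : [set z] `<=` N by move=> x ->; exact: AN.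
  by rewrite Qz => /(_ zN)/eqP; rewrite eqe invr_eq0 pnatr_eq0.
rewrite /chi2_mi asboolT //.
set f := Radon_Nikodym _ _.
(* Each point has mass 1/4 under the product of the marginals, so the density is determined
   everywhere and not merely almost everywhere. *)
have fz z : fine (f z) = 4 * q z.
  have fin : f z \is a fin_num by exact: Radon_Nikodym_fin_num.
  have : nu [set z] = (\int[Q]_(x in [set z]) f x)%E.
    exact: (Radon_Nikodym_integral (nu := charge_of_finite_measure nu) dom (measurable_bool2 _)).
  rewrite (eq_integral (fun=> f z)); last by move=> x; rewrite inE => ->.
  rewrite integral_cst; last exact: measurable_bool2.
  have -> : nu [set z] = (q z)%:E := muE nu (measurable_bool2 [set z]).
  have QE : Q [set z] = (4^-1)%:E := Qz z.
  move=> E; have {E} : (q z)%:E = (f z * (4^-1)%:E)%E.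
    by rewrite E; congr (_ * _)%E.
  by rewrite -(fineK fin) -EFinM => -[->]; rewrite fineK //; field.
rewrite integral_bool2; last by move=> z; exact: sqr_ge0.
rewrite lee_fin sumE /bool2 !big_cons !big_nil /= !fz !addr0 !mul1r !mul0r !add0r.
have muQ z : mu Q [set z] = 4^-1 by rewrite /mu Qz.
rewrite -/Q !muQ; apply: bool2_law_bound => //; exact: mu_ge0.
Qed.

End ChiSquare.

Lemma chi2_mi_ge0 (R : realType) (nu : probability (bool * bool)%type R) :
  (0 <= chi2_mi nu)%E.
Proof.
rewrite /chi2_mi; case: asboolP => // _.
by apply: integral_ge0 => z _; rewrite lee_fin sqr_ge0.
Qed.

(** * Graph distance and the limit *)

Lemma lattice_path n (u : vertex) : (`|u.1| + `|u.2|)%N = n ->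
  exists p, [/\ path adj origin p, last origin p = u & size p = n].
Proof.
elim: n u => [|n IH] [x y] /= un.
  by exists [::]; split => //=; rewrite /origin; congr (_, _); lia.
have [u' un' uu'] : exists2 u' : vertex, (`|u'.1| + `|u'.2|)%N = n & adj u' (x, y).
  rewrite /adj /l1dist; have [x0|x0|x0] := ltgtP x 0.
  - by exists (x + 1, y) => /=; lia.
  - by exists (x - 1, y) => /=; lia.
  have [y0|y0|y0] := ltgtP y 0.
  - by exists (x, y + 1) => /=; lia.
  - by exists (x, y - 1) => /=; lia.
  by move: un; rewrite x0 y0.
have [p [pp pl ps]] := IH u' un'; exists (rcons p (x, y)); split.
- by rewrite rcons_path pp pl.
- by rewrite last_rcons.
- by rewrite size_rcons ps.
Qed.

(** Sites of [rect N N] have l1 norm at most [2 * N], and [lattice_path] bounds the graph distance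
    to the origin by the l1 norm. *)
Lemma far_from_origin (N k : nat) (v : vertex) :
  (2 * N < k)%N -> graph_dist adj origin v k -> ~ rect N N v.
Proof.
move=> Nk [_ short] [r1 r2].
have [p [pp pl ps]] := lattice_path (erefl (`|v.1| + `|v.2|)%N).
by have := short p pp pl; rewrite ps; lia.
Qed.

Section Instance.
Context d (Omega : measurableType d) (R : realType) (P : probability Omega R).
Variables (eps : R) (X : vertex -> {RV P >-> bool}) (Y : edge -> {RV P >-> bool}).
Hypothesis XY : sync_instance eps X Y.
Hypothesis eps01 : 0 <= eps <= 1.
Notation sigY := (sigma_gen (fun e => Y e : Omega -> bool)).

Lemma signedE g B : cyl g -> measurable B ->
  signed X g B = 2 * mu P (~` spin_event X g `&` B) - mu P B.
Proof.
move=> cg mB; have mG := measurable_spin_event X cg.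
by rewrite (mu_split P mB mG) /signed [~` _ `&` B]setIC; lra.
Qed.

Lemma cond_chi2_mi_le (v : vertex) (b : R)
    (kappa : Omega -> probability (bool * bool)%type R) :
  is_cond_law P sigY (fun w => (X origin w, X v w)) kappa ->
  (forall B, sigY B -> `|signed X (same_spin origin v) B| <= b) ->
  (cond_chi2_mi P kappa <= (2 * b)%:E)%E.
Proof.
move=> law hb; have GM : sigY `<=` measurable by move=> B /sigma_obs_approx[].
pose p S w := mu (kappa w) S.
have p0 S w : 0 <= p S w by exact: mu_ge0.
have cp S A : (fun w => (X origin w, X v w)) @^-1` S = A ->
    is_cond_prob P sigY A (fun w => (p S w)%:E).
  move=> <-; have := law S (@measurable_bool2 S).
  by congr is_cond_prob; apply/funext => w; exact: (muE (kappa w) (measurable_bool2 S)).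
have uniform (u : site) S : (fun w => (X origin w, X v w)) @^-1` S = spin_event X (fun x => x u) ->
    exists N, [/\ measurable N, P N = 0%E & forall w, ~ N w -> p S w = 2^-1].
  move=> SE; have cg : cyl (fun x : site -> bool => x u).
    by exists [:: u] => x x' h; rewrite h // mem_head.
  have mA := measurable_spin_event X cg.
  apply: (cond_prob_half GM mA (cp _ _ SE)) => // B sB.
  have := signed_spin_sigma XY eps01 u sB; rewrite signedE //; last exact: GM.
  by rewrite (mu_split P (GM _ sB) mA) [B `&` _]setIC [B `&` _]setIC; lra.
have [N1 [mN1 PN1 hN1]] := uniform origin [set z : bool * bool | z.1] erefl.
have [N2 [mN2 PN2 hN2]] := uniform v [set z : bool * bool | z.2] erefl.
pose g := same_spin origin v; have cg : cyl g := cyl_same_spin origin v.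
pose D := [set z : bool * bool | ~~ (z.1 (+) z.2)].
have DE : (fun w => (X origin w, X v w)) @^-1` D = ~` spin_event X g.
  by apply/seteqP; split => w /negP.
have cD := cp _ _ DE; have mD := measurableC (measurable_spin_event X cg).
(* The pointwise bound holds off [N1] and [N2], where both conditional marginals are uniform. *)
apply: le_trans (_ : (\int[P]_w `|2 * p D w - 1|%:E <= _)%E).
  apply: (integral_le_off_null (N := N1 `|` N2)).
  - exact: measurableU.
  - rewrite muE; last exact: measurableU.
    congr (_%:E); apply/eqP; rewrite eq_le mu_ge0 andbT.
    by apply: le_trans (mu_U P mN1 mN2) _; rewrite /mu PN1 PN2 addr0.
  - apply/measurable_EFinP; apply: measurableT_comp => //.
    apply: measurable_funB => //; apply: measurable_funM => //.
    exact: cond_prob_measurable cD.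
  - by move=> w; exact: chi2_mi_ge0.
  - by move=> w; rewrite lee_fin.
  - move=> w nN; apply: chi2_mi_uniform; first by apply: hN1 => ?; apply: nN; left.
    by apply: hN2 => ?; apply: nN; right.
rewrite (integral_cond_prob_dist GM mD cD (p0 D)) lee_fin.
set B := [set w | _ <= _].
have GB : sigY B.
  have -> : B = p D @^-1` `[2^-1, +oo[ by apply/seteqP; split => w; rewrite /= in_itv /= andbT.
  exact: cond_prob_sigma cD _ (measurable_itv _).
(* The factor 2 of the bound: one [b] for the event where the conditional mean is nonnegative, one
   for its complement. *)
have GBc : sigY (~` B) by exact: sigma_algebraC.
have := hb _ GB; have := hb _ GBc.
rewrite -/g !signedE //; try exact: GM.
by rewrite !ler_norml => /andP[? ?] /andP[? ?]; lra.
Qed.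

End Instance.

Theorem mainTheorem3 (R : realType) (d : measure_display)
  (Omega : measurableType d) (P : probability Omega R)
  (eps : R) (eps_ge0 : 0 <= eps) (eps_le1 : eps <= 1)
  (X : vertex -> {RV P >-> bool}) (Y : edge -> {RV P >-> bool})
  (XY : sync_instance eps X Y)
  (v : nat -> vertex)
  (v_dist : forall k : nat, (0 < k)%N -> graph_dist adj origin (v k) k)
  (kappa : nat -> Omega -> probability (bool * bool)%type R)
  (kappa_law : forall k : nat, (0 < k)%N ->
     is_cond_law P (sigma_gen (fun e => Y e : Omega -> bool))
       (fun w => (X origin w, X (v k) w)) (kappa k)) :
  (1 - 2 * eps) ^+ 2 <= 2^-1 ->
  cond_chi2_mi P (kappa k) @[k --> \oo] --> (0 : \bar R).
Proof.
move=> eps2; have eps01 : 0 <= eps <= 1 by rewrite eps_ge0.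
have small (b : R) : 0 < b ->
    exists m, forall k, (m <= k)%N -> (cond_chi2_mi P (kappa k) <= b%:E)%E.
  move=> b0; have [|N hN] := small_correlation XY eps01 eps2 (b := b / 2).
    by rewrite divr_gt0.
  exists (2 * N).+1 => k Nk; have k0 : (0 < k)%N by exact: leq_trans Nk.
  have := cond_chi2_mi_le XY eps01 (kappa_law k k0) (hN _ (far_from_origin Nk (v_dist k k0))).
  by rewrite mulrC divfK.
have ge0 k : (0 <= cond_chi2_mi P (kappa k))%E.
  by apply: integral_ge0 => w _; exact: chi2_mi_ge0.
(* The information is an extended real; the bound by 1 makes it finite from some index on. *)
apply/fine_cvgP; split.
  have [m hm] := small 1 ltr01; exists m => // k /= mk.
  by rewrite ge0_fin_numE //; apply: le_lt_trans (hm k mk) (ltry _).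
apply/cvgrPdist_le => b b0; have [m hm] := small b b0.
exists m => // k /= mk; rewrite sub0r normrN ger0_norm ?fine_ge0 //.
rewrite -lee_fin fineK; first exact: hm.
by rewrite ge0_fin_numE //; apply: le_lt_trans (hm k mk) (ltry _).
Qed.
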